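(* Assume that $a$ is locally Lipschitz continuous and that one of the following two conditions holds: (i) (K1), (K3)$'$, (K4), (K6), (K7)$'$, (K8), (K9) hold and $$\kappa:=\inf_{p\in\mathbf R}\inf_{x\in\mathbf R}\int_{\mathbf R}K(x,y)e^{p(y-x)}\,dy-\sup_{x\in\mathbf R}a(x)+\inf_{x\in\mathbf R}a(x)>0;$$ (ii) (K1), (K3)$'$, (K4), (K7), (K9) hold and $K(x,y)=K(x-y)$ (i.e. $K$ depends only on $x-y$). If $K(x,y)=K(y,x)$ for all $x,y$, then for every $p\in\mathbf R$ $$\underline{\lambda_1}(p,-\infty)=\overline{\lambda_1}(p,-\infty)=\underline{\lambda_1^-}(p,-\infty)=\overline{\lambda_1^-}(p,-\infty).$$ (All conditions and the generalized principal eigenvalues are defined in the context.)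
   Context: Setting. $K(x,y)\ge 0$ on $\mathbf R^2$; $K\phi(x):=\int_{\mathbf R}K(x,y)\phi(y)\,dy$; $b(x):=\int_{\mathbf R}K(x,y)\,dy$; $K_p(x,y):=K(x,y)e^{p(y-x)}$ for $p\in\mathbf R$. The function $f:\mathbf R\times[0,1]\to\mathbf R$ satisfies $f(x,0)\equiv f(x,1)\equiv 0$; $0<\inf_{x}f(x,s)\le f(x,s)\le f_s'(x,0)s$ for $s\in(0,1)$; $f_s'(\cdot,0)\in C(\mathbf R)$; $\sup_{x}\|f(x,\cdot)\|_{\mathcal C^{1+\gamma}([0,1])}<+\infty$ for some $\gamma>0$. Put $a(x):=b(x)-f_s'(x,0)$, and, for $p\in\mathbf R$, $\underline c=\inf_x\{\int_{\mathbf R}K_p(x,y)\,dy-a(x)\}$, $\overline c=\sup_x\{\int_{\mathbf R}K_p(x,y)\,dy-a(x)\}$. $B_r(x)$ is the open interval of radius $r$ about $x$, $B_r^c(x)$ its complement. Conditions (those involving $p$ are required for every $p\in\mathbf R$). (K1) $K$ maps $C(\mathbf R)$ to $C(\mathbf R)$, and $x\mapsto\int_{\mathbf R}K(x,x-\xi)e^{-p\xi}\,d\xi$ belongs to $L^\infty(\mathbf R)\cap C(\mathbf R)$ for every $p$. (K3)$'$ There are $\theta_0,\Delta,k_0>0$ with $K(x,y)\ge\theta_0$ for $|x-y|\le\Delta$ and $K(x,y)\le k_0$ for all $(x,y)$. (K4) $k(p):=\liminf_{R\to\infty}\inf_{|x|\ge R}\{\int_{\mathbf R}K(x,x-\xi)e^{-p\xi}\,d\xi-b(x)+f_s'(x,0)\}>0$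 for all $p$, and $\lim_{p\to+\infty}k(\pm p)/p=\lim_{p\to0^+}k(\pm p)/p=+\infty$. (K6) For every $R>0$, $\int_{B_R(0)}|K_p(x,x-s)-K_p(x+\xi,x+\xi-s)|\,ds\to0$ as $|\xi|\to0$, uniformly in $x\in\mathbf R$. (K7) There exist $\varepsilon_0>0$ and $r(\varepsilon)>0$ such that $\alpha_p:=\sup_{x\in\mathbf R,\ \varepsilon\in(0,\varepsilon_0]}\frac{\int_{B_{r(\varepsilon)}^c(x)}K_p(x,y)\,dy}{\int_{\mathbf R}K_p(x,y)\,dy}\exp\big(\frac{\overline c-\underline c}{\varepsilon}\big)<1$ and $\varepsilon r(\varepsilon)\to0$ as $\varepsilon\to0^+$. (K7)$'$ There is $r_0>\Delta$ such that $K(x,y)=0$ if $|x-y|\ge r_0$. (K8) Every sequence $\{x_n\}\subset\mathbf R$ has a subsequence (still denoted $x_n$) such that $\int_{B_{r_0}(0)}|K_p(x+x_n,x+x_n-s)-K_p(x+x_m,x+x_m-s)|\,ds\to0$ as $n,m\to\infty$, uniformly in $x\in\mathbf R$. (K9) $a$ is almost periodic: for every sequence $x_n$ there is a subsequence $x_{n_k}$ such that $a(\cdot+x_{n_k})$ converges uniformly on $\mathbf R$. Generalized principal eigenvalues. $L_p\phi(x)=\int_{\mathbf R}K(x,y)e^{p(y-x)}\phi(y)\,dy-a(x)\phi(x)$. $\mathcal A$ is the set of uniformly continuous $\phi\in C(\mathbf R)$ with $0<\inf_{\mathbf R}\phi\le\sup_{\mathbf R}\phi<+\infty$. Then $\underline{\lambda_1}(p,-\infty)=\sup\{\lambda:\exists\phi\in\mathcal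 A,\ L_p\phi\ge\lambda\phi\text{ on }\mathbf R\}$, $\overline{\lambda_1}(p,-\infty)=\inf\{\lambda:\exists\phi\in\mathcal A,\ L_p\phi\le\lambda\phi\text{ on }\mathbf R\}$. The quantities $\underline{\lambda_1^-}(p,-\infty)$ and $\overline{\lambda_1^-}(p,-\infty)$ are defined in the same way with $L_p$ replaced by $L_p^-\phi(x)=\int_{\mathbf R}K^-(x,y)e^{p(y-x)}\phi(y)\,dy-a^-(x)\phi(x)$, where $K^-(x,y)=K(-x,-y)$ and $a^-(x)=a(-x)$. *)

(* Defs.v *)
From HB Require Import structures.
From mathcomp Require Import all_boot all_order all_algebra.
From mathcomp Require Import all_classical all_reals all_analysis.

Set Implicit Arguments.
Unset Strict Implicit.
Unset Printing Implicit Defensive.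

Import Order.TTheory GRing.Theory Num.Theory.
Import numFieldNormedType.Exports.

Local Open Scope classical_set_scope.
Local Open Scope ring_scope.

Definition esup_over (R : realType) (T : Type) (g : T -> R) (A : set T) : \bar R :=
  ereal_sup [set (g x)%:E | x in A].

Definition einf_over (R : realType) (T : Type) (g : T -> R) (A : set T) : \bar R :=
  ereal_inf [set (g x)%:E | x in A].

Definition locally_lipschitz (R : realType) (g : R -> R) : Prop :=
  forall x : R, exists2 r : R, 0 < r & [lipschitz g y | y in ball x r].

(** Kernels *)

Definition Kp (R : realType) (K : R -> R -> R) (p : R) : R -> R -> R :=
  fun x y => K x y * expR (p * (y - x)).

Definition Kop (R : realType) (K : R -> R -> R) (phi : R -> R) : R -> R :=
  fun x => \int[@lebesgue_measure R]_y (K x y * phi y).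

Definition mass (R : realType) (K : R -> R -> R) : R -> R :=
  fun x => \int[@lebesgue_measure R]_y K x y.

(* The function x |-> \int K(x, x - xi) e^{-p xi} d xi; the change of variables
   y = x - xi turns it into [mass (Kp K p)]. *)
Definition shifted_mass (R : realType) (K : R -> R -> R) (p : R) : R -> R :=
  fun x => \int[@lebesgue_measure R]_xi (K x (x - xi) * expR (- (p * xi))).

Definition nonneg_kernel (R : realType) (K : R -> R -> R) : Prop :=
  measurable_fun [set: R * R] (fun z : R * R => K z.1 z.2) /\
  forall x y, 0 <= K x y.

Definition symmetric_kernel (R : realType) (K : R -> R -> R) : Prop :=
  forall x y, K x y = K y x.

Definition convolution_kernel (R : realType) (K : R -> R -> R) : Prop :=
  exists k : R -> R, forall x y, K x y = k (x - y).

Definition reflK (R : realType) (K : R -> R -> R) : R -> R -> R :=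
  fun x y => K (- x) (- y).

Definition refl (R : realType) (g : R -> R) : R -> R := fun x => g (- x).

(** The nonlinearity.  [f x s] is only ever inspected for [s] in [0, 1]; the
    derivatives in [s] are relative to [0, 1], hence one-sided at 0 and 1. *)

Definition dquot (R : realType) (g : R -> R) (s t : R) : R := (g t - g s) / (t - s).

Definition derivable01 (R : realType) (g : R -> R) (s : R) : Prop :=
  cvg (dquot g s t @[t --> within `[0, 1] s^']).

Definition deriv01 (R : realType) (g : R -> R) (s : R) : R :=
  lim (dquot g s t @[t --> within `[0, 1] s^']).

(* ||g||_oo + ||g'||_oo + [g']_gamma over [0, 1], where 0 < gamma <= 1 *)
Definition C1gamma_norm (R : realType) (gamma : R) (g : R -> R) : \bar R :=
  (esup_over (fun s => `|g s|%R) `[0%R, 1%R] +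
   esup_over (fun s => `|deriv01 g s|%R) `[0%R, 1%R] +
   esup_over (fun z : R * R =>
       (`|deriv01 g z.1 - deriv01 g z.2| / (`|z.1 - z.2| `^ gamma))%R)
     [set z | [/\ z.1 \in `[0%R, 1%R], z.2 \in `[0%R, 1%R] & z.1 != z.2]])%E.

Definition fs0 (R : realType) (f : R -> R -> R) : R -> R :=
  fun x => deriv01 (f x) 0.

Definition KPP_nonlinearity (R : realType) (f : R -> R -> R) : Prop :=
  [/\ forall x, f x 0 = 0 /\ f x 1 = 0,
      forall s, 0 < s < 1 ->
        (0 < einf_over (fun x => f x s) setT)%E /\
        (forall x, f x s <= fs0 f x * s),
      continuous (fs0 f),
      forall x s, s \in `[0, 1] -> derivable01 (f x) s
    & exists2 gamma : R, 0 < gamma <= 1 &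
        (ereal_sup (range (fun x => C1gamma_norm gamma (f x))) < +oo)%E].

Definition coef_a (R : realType) (K : R -> R -> R) (f : R -> R -> R) : R -> R :=
  fun x => mass K x - fs0 f x.

(** Hypotheses on the kernel *)

(* The condition that K maps C(R) to C(R) is imposed on bounded continuous phi,
   for which K phi is defined everywhere. *)
Definition K1 (R : realType) (K : R -> R -> R) : Prop :=
  (forall phi : R -> R, continuous phi ->
     (exists M : R, forall y, `|phi y| <= M) -> continuous (Kop K phi)) /\
  (forall p : R,
     [/\ forall x, (@lebesgue_measure R).-integrable setT
           (fun xi => (K x (x - xi) * expR (- (p * xi)))%:E),
         exists M : R, forall x, `|shifted_mass K p x| <= M
       & continuous (shifted_mass K p)]).

Definition K3' (R : realType) (K : R -> R -> R) (theta0 Delta k0 : R) : Prop :=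
  [/\ 0 < theta0, 0 < Delta, 0 < k0,
      forall x y, `|x - y| <= Delta -> theta0 <= K x y
    & forall x y, K x y <= k0].

Definition kinf (R : realType) (K : R -> R -> R) (f : R -> R -> R) (p : R) : \bar R :=
  limf_einf (fun r : R =>
      einf_over (fun x => shifted_mass K p x - mass K x + fs0 f x)
        [set x | r <= `|x|])
    (pinfty_nbhs R).

Definition K4 (R : realType) (K : R -> R -> R) (f : R -> R -> R) : Prop :=
  [/\ forall p, (0 < kinf K f p)%E,
      (kinf K f p * (p^-1)%:E)%E @[p --> +oo] --> +oo%E,
      (kinf K f (- p) * (p^-1)%:E)%E @[p --> +oo] --> +oo%E,
      (kinf K f p * (p^-1)%:E)%E @[p --> 0^'+] --> +oo%E
    & (kinf K f (- p) * (p^-1)%:E)%E @[p --> 0^'+] --> +oo%E].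

Definition diag_dist (R : realType) (K : R -> R -> R) (p r u v : R) : R :=
  \int[@lebesgue_measure R]_(s in ball (0 : R) r)
    `|Kp K p u (u - s) - Kp K p v (v - s)|.

Definition K6 (R : realType) (K : R -> R -> R) : Prop :=
  forall p r : R, 0 < r -> forall e : R, 0 < e ->
    \forall xi \near (0 : R), forall x, diag_dist K p r x (x + xi) < e.

Definition c_low (R : realType) (K : R -> R -> R) (f : R -> R -> R) (p : R) : R :=
  inf (range (fun x => mass (Kp K p) x - coef_a K f x)).

Definition c_up (R : realType) (K : R -> R -> R) (f : R -> R -> R) (p : R) : R :=
  sup (range (fun x => mass (Kp K p) x - coef_a K f x)).

Definition tail_ratio (R : realType) (K : R -> R -> R) (p x r : R) : R :=
  (\int[@lebesgue_measure R]_(y in ~` ball x r) Kp K p x y) / mass (Kp K p) x.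

Definition alpha (R : realType) (K : R -> R -> R) (f : R -> R -> R)
    (eps0 : R) (r : R -> R) (p : R) : \bar R :=
  esup_over (fun z : R * R =>
      tail_ratio K p z.1 (r z.2) * expR ((c_up K f p - c_low K f p) / z.2))
    [set z | 0 < z.2 <= eps0].

Definition K7 (R : realType) (K : R -> R -> R) (f : R -> R -> R) : Prop :=
  forall p : R, exists (eps0 : R) (r : R -> R),
    [/\ 0 < eps0, forall eps : R, 0 < eps <= eps0 -> 0 < r eps,
        (alpha K f eps0 r p < 1)%E
      & eps * r eps @[eps --> 0^'+] --> (0 : R)].

Definition K7' (R : realType) (K : R -> R -> R) (Delta r0 : R) : Prop :=
  Delta < r0 /\ forall x y, r0 <= `|x - y| -> K x y = 0.

Definition K8 (R : realType) (K : R -> R -> R) (r0 : R) : Prop :=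
  forall (p : R) (u : nat -> R), exists2 sigma : nat -> nat,
    {homo sigma : n m / (n < m)%N} &
    forall e : R, 0 < e ->
      \forall n \near \oo & m \near \oo, forall x,
        diag_dist K p r0 (x + u (sigma n)) (x + u (sigma m)) < e.

Definition almost_periodic (R : realType) (g : R -> R) : Prop :=
  forall u : nat -> R, exists2 sigma : nat -> nat,
    {homo sigma : n m / (n < m)%N} &
    exists h : R -> R, forall e : R, 0 < e ->
      \forall n \near \oo, forall x, `|g (x + u (sigma n)) - h x| < e.

Definition kappa (R : realType) (K : R -> R -> R) (f : R -> R -> R) : R :=
  inf (range (fun p => inf (range (mass (Kp K p)))))
  - sup (range (coef_a K f)) + inf (range (coef_a K f)).

Definition condition_i (R : realType) (K : R -> R -> R) (f : R -> R -> R) : Prop :=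
  (exists theta0 Delta k0 r0 : R,
     [/\ K3' K theta0 Delta k0, K7' K Delta r0 & K8 K r0]) /\
  [/\ K1 K, K4 K f, K6 K, almost_periodic (coef_a K f) & 0 < kappa K f].

Definition condition_ii (R : realType) (K : R -> R -> R) (f : R -> R -> R) : Prop :=
  (exists theta0 Delta k0 : R, K3' K theta0 Delta k0) /\
  [/\ K1 K, K4 K f, K7 K f, almost_periodic (coef_a K f)
    & convolution_kernel K].

(** Generalized principal eigenvalues *)

Definition Lop (R : realType) (K : R -> R -> R) (a : R -> R) (p : R)
    (phi : R -> R) : R -> R :=
  fun x => \int[@lebesgue_measure R]_y (K x y * expR (p * (y - x)) * phi y)
           - a x * phi x.

Definition admissible (R : realType) (phi : R -> R) : Prop :=
  [/\ unif_continuous phi, (0 < einf_over phi setT)%E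
    & (esup_over phi setT < +oo)%E].

Definition lambda_low (R : realType) (K : R -> R -> R) (a : R -> R) (p : R) : \bar R :=
  ereal_sup [set lambda%:E | lambda in [set lambda : R |
    exists2 phi, admissible phi & forall x, lambda * phi x <= Lop K a p phi x]].

Definition lambda_up (R : realType) (K : R -> R -> R) (a : R -> R) (p : R) : \bar R :=
  ereal_inf [set lambda%:E | lambda in [set lambda : R |
    exists2 phi, admissible phi & forall x, Lop K a p phi x <= lambda * phi x]].

(* Main.v *)
(** Write P_p(x,y) = K(x,y) e^{p(y-x)}.  Reflection turns the eigenvalues of
    L_p^- into those of L_{-p}, so it suffices to close the cycle
      low(p) <= up(-p) <= low(-p) <= up(p) <= low(p).

    low(p) <= up(-p): by symmetry of K the transpose of P_p is P_{-p}.  Test a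
    subsolution phi for p against a supersolution psi for -p by integrating
    psi L_p phi and phi L_{-p} psi over a long window [-r,r].  The two double
    integrals agree up to the mass that P_p exchanges with the outside of the
    window; this is o(r), whereas the integral of phi psi is of order r.

    up(p) <= low(p): shift L_p by a constant to a positive operator Q.  For
    0 < eps < 1 the map w |-> ln (Q e^{(1-eps)w}) is a (1-eps)-contraction for
    the sup norm; let w be an almost fixed point and phi = e^{(1-eps)w}.  Then
    Q phi / phi is nearly e^{eps w}, so it suffices that eps w oscillates little
    when eps is small.  On a fixed bounded interval this follows from the
    positivity of K near the diagonal.  Almost periodicity brings every point
    into such an interval, since translates that nearly preserve K and a nearly
    preserve eps w.  That last step compares phi at the points of the support of
    K(x,.) with phi(x): nothing is to be compared for a convolution kernel, and
    otherwise the condition kappa > 0 yields a Harnack inequality. *)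

Require Import Defs.
From HB Require Import structures.
From mathcomp Require Import all_boot all_order all_algebra.
From mathcomp Require Import all_classical all_reals all_analysis.
From mathcomp Require Import measurable_realfun ring lra.

Set Implicit Arguments.
Unset Strict Implicit.
Unset Printing Implicit Defensive.

Import Order.TTheory GRing.Theory Num.Theory.
Import numFieldNormedType.Exports.

Local Open Scope classical_set_scope.
Local Open Scope ring_scope.

(** * Invariance of the Lebesgue integral under [x |-> c - x] *)

Section change_of_variables.
Context {R : realType}.
Local Notation mu := (@lebesgue_measure R).
Implicit Types (c : R) (g : R -> R).

Let rflip c : measurableTypeR R -> measurableTypeR R := fun s => c - s.

Let measurable_rflip c : measurable_fun setT (rflip c).
Proof. by apply: measurable_funB => //; exact: measurable_cst. Qed.

(** The Lebesgue measure is determined by its values on the intervals []a, b]], and the preimage [[c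
    - b, c - a[] has the same length. *)
Let pushforward_rflip c (A : set R) : measurable A ->
  pushforward mu (rflip c) A = mu A.
Proof.
move=> mA; pose mixin := isMeasurableFun.Build _ _ _ _ _ (measurable_rflip c).
pose phi : {mfun measurableTypeR R >-> measurableTypeR R} := HB.pack (rflip c) mixin.
apply/esym; apply: (@lebesgue_measure_unique R (pushforward mu phi)) => //= _ [[a b]] _ <-.
rewrite /pushforward/=.
have -> : rflip c @^-1` `]a, b]%classic = `[c - b, c - a[%classic.
  by apply/seteqP; split => x /=; rewrite /rflip !in_itv/= => /andP[? ?]; apply/andP; split; lra.
rewrite !lebesgue_measure_itv/= !lte_fin ltrD2l ltrN2.
by case: ifP => // _; rewrite -!EFinD; congr EFin; lra.
Qed.

Lemma ge0_integral_subr c (g : R -> \bar R) : measurable_fun setT g ->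
  (forall x, 0 <= g x)%E -> (\int[mu]_x g (c - x)%R = \int[mu]_x g x)%E.
Proof.
move=> mg g0; transitivity (\int[pushforward mu (rflip c)]_(x in setT) g x)%E.
  by rewrite (ge0_integral_pushforward (measurable_rflip c)).
by apply: eq_measure_integral => A mA _; exact: pushforward_rflip.
Qed.

Lemma integrable_subr c g : mu.-integrable setT (EFin \o g) ->
  mu.-integrable setT (EFin \o (fun x => g (c - x))).
Proof.
move=> /integrableP[mg ig]; apply/integrableP; split.
  exact: (measurableT_comp mg (measurable_rflip c)).
rewrite (ge0_integral_subr c (g := fun x => `|(g x)%:E|%E))//.
exact: measurableT_comp mg.
Qed.

Lemma Rintegral_subr c g : mu.-integrable setT (EFin \o g) ->
  \int[mu]_x g (c - x) = \int[mu]_x g x.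
Proof.
move=> ig; have mg := measurable_int mu ig.
congr fine.
transitivity (\int[pushforward mu (rflip c)]_(x in setT) (g x)%:E)%E.
  by rewrite (integral_pushforward (measurable_rflip c) mg)//; exact: integrable_subr.
by apply: eq_measure_integral => A mA _; exact: pushforward_rflip.
Qed.
End change_of_variables.

(** * Closure properties of integrable real functions *)

Section integrability.
Context {R : realType}.
Local Notation mu := (@lebesgue_measure R).
Implicit Types (g k phi : R -> R).

Lemma integrable_dominated g k : measurable_fun setT g ->
  (forall x, `|g x| <= k x) -> mu.-integrable setT (EFin \o k) ->
  mu.-integrable setT (EFin \o g).
Proof.
move=> mg gk; apply: le_integrable => //; first exact/measurable_EFinP.
by move=> x _ /=; rewrite lee_fin (le_trans (gk x))// ler_norm.
Qed.

Lemma measurable_funR_int k : mu.-integrable setT (EFin \o k) -> measurable_fun setT k.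
Proof. by move=> /(measurable_int mu)/measurable_EFinP. Qed.

Lemma integrable_mul_bounded k phi C : mu.-integrable setT (EFin \o k) ->
  measurable_fun setT phi -> (forall x, `|phi x| <= C) ->
  mu.-integrable setT (EFin \o (fun x => k x * phi x)).
Proof.
move=> ik mphi phiC; have mk := measurable_funR_int ik.
apply: (@integrable_dominated _ (fun x => `|k x| * C)).
- exact: measurable_funM.
- by move=> x; rewrite normrM ler_wpM2l.
- by apply: (@integrableZr _ _ _ mu setT measurableT C (EFin \o (fun x => `|k x|))) => //; exact: integrable_norm.
Qed.

Lemma integrableZ k (c : R) : mu.-integrable setT (EFin \o k) ->
  mu.-integrable setT (EFin \o (fun x => c * k x)).
Proof. by move=> ik; exact: (@integrableZl _ _ _ mu setT measurableT c (EFin \o k)). Qed.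

Lemma integrable_add g k : mu.-integrable setT (EFin \o g) ->
  mu.-integrable setT (EFin \o k) ->
  mu.-integrable setT (EFin \o (fun x => g x + k x)).
Proof.
move=> ig ik; have := @integrableD _ _ _ mu setT measurableT _ _ ig ik.
by apply: eq_integrable => // x _ /=; rewrite EFinD.
Qed.

Lemma integrable_sub g k : mu.-integrable setT (EFin \o g) ->
  mu.-integrable setT (EFin \o k) ->
  mu.-integrable setT (EFin \o (fun x => g x - k x)).
Proof.
move=> ig ik; have := @integrableB _ _ _ mu setT measurableT _ _ ig ik.
by apply: eq_integrable => // x _ /=; rewrite EFinB.
Qed.

End integrability.

(** * Tonelli's theorem on the plane *)

Section tonelli.
Context {R : realType}.
Local Notation mu := (@lebesgue_measure R).
Implicit Types f : R * R -> \bar R.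

(* [R * R] carries the product of the default display of [R], not the one of
   the Lebesgue measure; the two sigma-algebras are convertible. *)
Lemma measurable_fun_prodR f : measurable_fun [set: R * R] f ->
  measurable_fun [set: (measurableTypeR R * measurableTypeR R)%type] f.
Proof. by move=> mf _ Y mY; exact: (mf measurableT Y mY). Qed.

Lemma tonelli_lebesgue f : measurable_fun [set: R * R] f ->
  (forall z, 0 <= f z)%E ->
  (\int[mu]_x \int[mu]_y f (x, y) = \int[mu]_y \int[mu]_x f (x, y))%E.
Proof.
move=> mf f0; have mf' := measurable_fun_prodR mf.
by apply: (@fubini_tonelli _ _ _ _ R mu mu f).
Qed.

Lemma measurable_integral_snd f : measurable_fun [set: R * R] f ->
  (forall z, 0 <= f z)%E -> measurable_fun [set: R] (fun x => \int[mu]_y f (x, y))%E.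
Proof.
move=> mf f0; have mf' := measurable_fun_prodR mf.
by apply: (@measurable_fun_fubini_tonelli_F _ _ _ _ R mu f).
Qed.

Lemma measurable_integral_fst f : measurable_fun [set: R * R] f ->
  (forall z, 0 <= f z)%E -> measurable_fun [set: R] (fun y => \int[mu]_x f (x, y))%E.
Proof.
move=> mf f0; have mf' := measurable_fun_prodR mf.
by apply: (@measurable_fun_fubini_tonelli_G _ _ _ _ R mu f).
Qed.
End tonelli.

(** * Symmetric windows and their indicators *)

Section indicator_of_interval.
Context {R : realType}.
Local Notation mu := (@lebesgue_measure R).

Definition ind (r : R) : R -> R := \1_(`[- r, r]).

Lemma indE (r x : R) : ind r x = (`|x| <= r)%R%:R.
Proof. by rewrite /ind indicE mem_setE in_itv/= -ler_norml. Qed.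

Lemma ind_ge0 (r x : R) : 0 <= ind r x. Proof. by rewrite indE ler0n. Qed.

Lemma ind_le1 (r x : R) : ind r x <= 1. Proof. by rewrite indE lern1 leq_b1. Qed.

Lemma measurable_ind (r : R) : measurable_fun setT (ind r).
Proof. exact: measurable_indic. Qed.

Lemma integrable_ind (r : R) : mu.-integrable setT (EFin \o ind r).
Proof. exact: integrable_indic_itv. Qed.

Lemma Rintegral_ind (r : R) : 0 <= r -> \int[mu]_x ind r x = 2 * r.
Proof.
move=> r0; rewrite /Rintegral integral_indic//= setIT lebesgue_measure_itv/= lte_fin.
case: ifPn => [_|]; first by rewrite -EFinD/=; lra.
by rewrite -leNgt /=; lra.
Qed.
End indicator_of_interval.

(** * Comparison of sub- and supersolutions for a kernel and its transpose *)

Lemma window_limit (R : realType) (l m c C M : R) : 0 < c -> 0 < C -> 0 <= M ->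
  (m < l -> forall d, 0 < d -> exists2 L, 0 < L & forall r, L <= r ->
     (l - m) * (c ^+ 2 * (2 * r)) <= C ^+ 2 * (2 * r * d + 2 * L * M)) ->
  l <= m.
Proof.
move=> c0 C0 M0 H; rewrite leNgt; apply/negP => ml.
pose e := (l - m) * c ^+ 2.
have c2 : 0 < c ^+ 2 by rewrite exprn_gt0.
have C2 : 0 < C ^+ 2 by rewrite exprn_gt0.
have e0 : 0 < e by rewrite mulr_gt0// subr_gt0.
(* This tolerance makes [C ^+ 2 * (2 * r * d)] equal to [r * e], half of the left side
   [2 * (r * e)]. The [r] below makes the other half exceed [2 * C ^+ 2 * (L * M)], a
   contradiction. *)
have d0 : 0 < e / (2 * C ^+ 2) by rewrite divr_gt0// mulr_gt0.
have [L L0 HL] := H ml _ d0.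
have CLM : 0 <= C ^+ 2 * (L * M).
  by apply: mulr_ge0; [exact: ltW|apply: mulr_ge0 => //; exact: ltW].
pose r := L + 4 * (C ^+ 2 * (L * M)) / e.
have Lr : L <= r.
  by rewrite /r lerDl; apply: divr_ge0; [exact: mulr_ge0|exact: ltW].
have := HL _ Lr.
have -> : C ^+ 2 * (2 * r * (e / (2 * C ^+ 2)) + 2 * L * M) = r * e + 2 * C ^+ 2 * (L * M).
  by field; rewrite gt_eqF.
have -> : (l - m) * (c ^+ 2 * (2 * r)) = 2 * (r * e) by rewrite /e; ring.
have -> : r * e = L * e + 4 * C ^+ 2 * (L * M).
  by rewrite /r; field; rewrite gt_eqF.
have : 0 < L * e by rewrite mulr_gt0.
lra.
Qed.

Section bilinear_comparison.
Context {R : realType}.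
Local Notation mu := (@lebesgue_measure R).
Variables (P : R -> R -> R) (a phi psi : R -> R) (M A c C l m : R).
Hypotheses (mP : measurable_fun setT (fun z : R * R => P z.1 z.2))
  (P0 : forall x y, 0 <= P x y)
  (iPr : forall x, mu.-integrable setT (EFin \o P x))
  (iPl : forall y, mu.-integrable setT (EFin \o P^~ y))
  (PM : forall x, \int[mu]_y P x y <= M)
  (tailP : forall d, 0 < d -> exists2 L, 0 < L &
     forall x r, `|x| + L <= r -> \int[mu]_y (P x y * (1 - ind r y)) <= d)
  (ma : measurable_fun setT a) (aA : forall x, `|a x| <= A)
  (c0 : 0 < c)
  (mphi : measurable_fun setT phi) (mpsi : measurable_fun setT psi)
  (phic : forall x, c <= phi x <= C) (psic : forall x, c <= psi x <= C)
  (phil : forall x, l * phi x <= \int[mu]_y (P x y * phi y) - a x * phi x)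
  (psim : forall y, \int[mu]_x (P x y * psi x) - a y * psi y <= m * psi y).

Lemma window_bound_gt0 : 0 < C.
Proof. by have /andP[? ?] := phic 0; rewrite (lt_le_trans c0)// (le_trans _ (_ : phi 0 <= C)). Qed.

Lemma window_phi_ge0 x : 0 <= phi x. Proof. by have /andP[+ _] := phic x; exact/le_trans/ltW. Qed.
Lemma window_psi_ge0 x : 0 <= psi x. Proof. by have /andP[+ _] := psic x; exact/le_trans/ltW. Qed.
Lemma window_phi_norm_le x : `|phi x| <= C. Proof. by rewrite ger0_norm ?window_phi_ge0//; case/andP: (phic x). Qed.
Lemma window_psi_norm_le x : `|psi x| <= C. Proof. by rewrite ger0_norm ?window_psi_ge0//; case/andP: (psic x). Qed.

Section window.
Variable r : R.
Hypothesis r0 : 0 <= r.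

(** Both variables are cut off, so that the two orders of integration give the same finite value:
    rows are estimated through [phil], columns through [psim]. *)
Definition window_form (z : R * R) : R := ind r z.1 * psi z.1 * (P z.1 z.2 * (phi z.2 * ind r z.2)).

Lemma measurable_window_form : measurable_fun setT window_form.
Proof.
apply: measurable_funM; first apply: measurable_funM.
- exact: (measurableT_comp (measurable_ind r)).
- exact: (measurableT_comp mpsi).
- apply: measurable_funM => //; apply: measurable_funM.
    exact: (measurableT_comp mphi).
  exact: (measurableT_comp (measurable_ind r)).
Qed.

Lemma window_form_ge0 z : 0 <= window_form z.
Proof. by rewrite /window_form !mulr_ge0 ?ind_ge0 ?window_psi_ge0 ?window_phi_ge0. Qed.

Lemma integrable_P_phi x : mu.-integrable setT (EFin \o (fun y => P x y * phi y)).
Proof. exact: (integrable_mul_bounded (iPr x) mphi window_phi_norm_le). Qed.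

Lemma integrable_P_psi y : mu.-integrable setT (EFin \o (fun x => P x y * psi x)).
Proof. exact: (integrable_mul_bounded (iPl y) mpsi window_psi_norm_le). Qed.

Lemma ind_norm_le1 y : `|ind r y| <= 1.
Proof. by rewrite ger0_norm ?ind_ge0// ind_le1. Qed.

Lemma integrable_P_phi_ind x : mu.-integrable setT (EFin \o (fun y => P x y * phi y * ind r y)).
Proof. exact: (integrable_mul_bounded (integrable_P_phi x) (measurable_ind r) ind_norm_le1). Qed.

Lemma integrable_P_psi_ind y : mu.-integrable setT (EFin \o (fun x => P x y * psi x * ind r x)).
Proof. exact: (integrable_mul_bounded (integrable_P_psi y) (measurable_ind r) ind_norm_le1). Qed.

Definition window_row x := \int[mu]_y window_form (x, y).
Definition window_col y := \int[mu]_x window_form (x, y).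

Lemma window_rowE x : window_row x = ind r x * psi x * \int[mu]_y (P x y * phi y * ind r y).
Proof.
rewrite -RintegralZl ?integrable_P_phi_ind//; apply: eq_Rintegral => y _; rewrite /window_form/=; ring.
Qed.

Lemma window_colE y : window_col y = ind r y * phi y * \int[mu]_x (P x y * psi x * ind r x).
Proof.
rewrite -RintegralZl ?integrable_P_psi_ind//; apply: eq_Rintegral => x _; rewrite /window_form/=; ring.
Qed.

Lemma integrable_window_form_snd x : mu.-integrable setT (EFin \o (fun y => window_form (x, y))).
Proof.
have := integrableZ (ind r x * psi x) (integrable_P_phi_ind x); apply: eq_integrable => // y _ /=.
by congr EFin; rewrite /window_form/=; ring.
Qed.

Lemma integrable_window_form_fst y : mu.-integrable setT (EFin \o (fun x => window_form (x, y))).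
Proof.
have := integrableZ (ind r y * phi y) (integrable_P_psi_ind y); apply: eq_integrable => // x _ /=.
by congr EFin; rewrite /window_form/=; ring.
Qed.

Lemma EFin_window_row x : (window_row x)%:E = (\int[mu]_y (window_form (x, y))%:E)%E.
Proof. by rewrite /window_row /Rintegral fineK//; apply: integrable_fin_num => //; exact: integrable_window_form_snd. Qed.

Lemma EFin_window_col y : (window_col y)%:E = (\int[mu]_x (window_form (x, y))%:E)%E.
Proof. by rewrite /window_col /Rintegral fineK//; apply: integrable_fin_num => //; exact: integrable_window_form_fst. Qed.

Lemma window_tonelli : \int[mu]_x window_row x = \int[mu]_y window_col y.
Proof.
have E : (\int[mu]_x (window_row x)%:E = \int[mu]_y (window_col y)%:E)%E.
  under eq_integral do rewrite EFin_window_row.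
  under [RHS]eq_integral do rewrite EFin_window_col.
  apply: (@tonelli_lebesgue _ (EFin \o window_form)).
    by apply/measurable_EFinP; exact: measurable_window_form.
  by move=> z /=; rewrite lee_fin window_form_ge0.
by rewrite /Rintegral E.
Qed.

Definition window_weight x := ind r x * phi x * psi x.

Lemma measurable_window_weight : measurable_fun setT window_weight.
Proof. by apply: measurable_funM => //; apply: measurable_funM => //; exact: measurable_ind. Qed.

Lemma integrableZ_ind k : mu.-integrable setT (EFin \o (fun x => k * ind r x)).
Proof. exact/integrableZ/integrable_ind. Qed.

Lemma window_weight_ge0 x : 0 <= window_weight x. Proof. by rewrite /window_weight !mulr_ge0 ?ind_ge0 ?window_psi_ge0 ?window_phi_ge0. Qed.

Lemma window_weight_le x : window_weight x <= C ^+ 2 * ind r x.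
Proof.
rewrite /window_weight -mulrA mulrC expr2 ler_wpM2r ?ind_ge0//.
have /andP[_ ?] := phic x; have /andP[_ ?] := psic x.
by apply: ler_pM; rewrite ?window_phi_ge0 ?window_psi_ge0.
Qed.

Lemma window_weight_ge x : c ^+ 2 * ind r x <= window_weight x.
Proof.
rewrite /window_weight -mulrA [leRHS]mulrC expr2 ler_wpM2r ?ind_ge0//.
have /andP[? _] := phic x; have /andP[? _] := psic x.
by apply: ler_pM; rewrite ?(ltW c0).
Qed.

Lemma integrable_mul_window_weight (g : R -> R) (B : R) : measurable_fun setT g -> (forall x, `|g x| <= B) ->
  mu.-integrable setT (EFin \o (fun x => g x * window_weight x)).
Proof.
move=> mg gB; have B0 : 0 <= B by rewrite (le_trans _ (gB 0)).
apply: (@integrable_dominated _ _ (fun x => B * C ^+ 2 * ind r x)).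
- by apply: measurable_funM => //; exact: measurable_window_weight.
- move=> x; rewrite normrM (ger0_norm (window_weight_ge0 x)) -mulrA.
  by apply: ler_pM; rewrite ?window_weight_ge0 ?window_weight_le.
- exact: integrableZ_ind.
Qed.

Lemma integrable_window_weight : mu.-integrable setT (EFin \o window_weight).
Proof.
apply: integrable_dominated (integrableZ_ind (C ^+ 2)); first exact: measurable_window_weight.
by move=> x; rewrite ger0_norm ?window_weight_ge0// window_weight_le.
Qed.

(** The cutoff in [x] only lowers the integral of a nonnegative function, so an upper bound survives
    it without an error term. *)
Lemma window_col_le y : window_col y <= (m + a y) * window_weight y.
Proof.
rewrite window_colE /window_weight.
have le1 : \int[mu]_x (P x y * psi x * ind r x) <= \int[mu]_x (P x y * psi x).
  apply: le_Rintegral => //; [exact: integrable_P_psi_ind|exact: integrable_P_psi|].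
  by move=> x _; rewrite ler_piMr ?ind_le1// mulr_ge0// window_psi_ge0.
have le2 : \int[mu]_x (P x y * psi x * ind r x) <= (m + a y) * psi y.
  by rewrite mulrDl -lerBlDr (le_trans _ (psim y))// lerB.
have -> : (m + a y) * (ind r y * phi y * psi y) = ind r y * phi y * ((m + a y) * psi y) by ring.
by rewrite ler_wpM2l// mulr_ge0 ?ind_ge0 ?window_phi_ge0.
Qed.

Definition leak x := \int[mu]_y (P x y * (1 - ind r y)).

Lemma integrable_leak x : mu.-integrable setT (EFin \o (fun y => P x y * (1 - ind r y))).
Proof.
apply: (@integrable_mul_bounded _ _ _ 1) => //.
  by apply: measurable_funB; [exact: measurable_cst|exact: measurable_ind].
by move=> y; rewrite ger0_norm ?subr_ge0 ?ind_le1// gerBl ind_ge0.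
Qed.

(** A lower bound does not survive the cutoff in [y]: since [phi <= C], the part of the integral
    lost is at most [C * leak x]. The factor [psi x <= C] supplies the second [C]. *)
Lemma window_row_ge x : (l + a x) * window_weight x <= window_row x + C ^+ 2 * (ind r x * leak x).
Proof.
rewrite window_rowE /window_weight.
have le1 : \int[mu]_y (P x y * phi y) <=
   \int[mu]_y (P x y * phi y * ind r y) + C * leak x.
  have i1 := integrable_P_phi_ind x; have i2 := integrableZ C (integrable_leak x).
  rewrite /leak -RintegralZl ?integrable_leak// -RintegralD//.
  apply: le_Rintegral => //; first exact: integrable_P_phi.
    exact: integrable_add.
  move=> y _; rewrite -subr_ge0.
  have -> : P x y * phi y * ind r y + C * (P x y * (1 - ind r y)) - P x y * phi y =
    P x y * (1 - ind r y) * (C - phi y) by ring.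
  have /andP[_ ?] := phic y.
  by rewrite !mulr_ge0// subr_ge0// ind_le1.
have le2 : (l + a x) * phi x <= \int[mu]_y (P x y * phi y * ind r y) + C * leak x.
  by rewrite mulrDl -lerBrDr (le_trans (phil x))// lerB.
have -> : (l + a x) * (ind r x * phi x * psi x) = ind r x * psi x * ((l + a x) * phi x) by ring.
apply: (@le_trans _ _ (ind r x * psi x * (\int[mu]_y (P x y * phi y * ind r y) + C * leak x))).
  by rewrite ler_wpM2l// mulr_ge0 ?ind_ge0 ?window_psi_ge0.
rewrite mulrDr lerD2l expr2.
have -> : ind r x * psi x * (C * leak x) = psi x * (C * (ind r x * leak x)) by ring.
rewrite -mulrA ler_wpM2r//; last by case/andP : (psic x).
rewrite !mulr_ge0 ?ind_ge0 ?(ltW window_bound_gt0)//; apply: Rintegral_ge0 => y _.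
by rewrite mulr_ge0// subr_ge0 ind_le1.
Qed.

Lemma integrable_window_row : mu.-integrable setT (EFin \o window_row).
Proof.
apply: (@integrable_dominated _ _ (fun x => C * (C * M) * ind r x)); last exact: integrableZ_ind.
  apply/measurable_EFinP; rewrite (_ : EFin \o window_row = fun x => (\int[mu]_y (window_form (x, y))%:E)%E); last first.
    by apply/funext => x /=; rewrite EFin_window_row.
  apply: (measurable_integral_snd (f := EFin \o window_form)).
    by apply/measurable_EFinP; exact: measurable_window_form.
  by move=> z; rewrite lee_fin window_form_ge0.
move=> x; rewrite ger0_norm; last by apply: Rintegral_ge0 => y _; exact: window_form_ge0.
rewrite window_rowE.
have le1 : \int[mu]_y (P x y * phi y * ind r y) <= C * M.
  apply: (@le_trans _ _ (C * \int[mu]_y P x y)); last first.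
    by rewrite ler_wpM2l// ltW ?window_bound_gt0.
  rewrite -RintegralZl//; apply: le_Rintegral => //; [exact: integrable_P_phi_ind|exact: integrableZ|].
  move=> y _; have /andP[_ ?] := phic y.
  apply: (@le_trans _ _ (P x y * phi y)); last by rewrite mulrC ler_wpM2r.
  by rewrite ler_piMr ?mulr_ge0 ?window_phi_ge0 ?ind_le1.
have ge1 : 0 <= \int[mu]_y (P x y * phi y * ind r y).
  by apply: Rintegral_ge0 => y _; rewrite !mulr_ge0 ?window_phi_ge0 ?ind_ge0.
have /andP[_ ?] := psic x.
rewrite -mulrA [leRHS]mulrC ler_wpM2l ?ind_ge0//.
by apply: ler_pM; rewrite ?window_psi_ge0.
Qed.

Lemma integrable_window_col : mu.-integrable setT (EFin \o window_col).
Proof.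
apply: (@integrable_dominated _ _ (fun y => (m + a y) * window_weight y)).
- apply/measurable_EFinP; rewrite (_ : EFin \o window_col = fun y => (\int[mu]_x (window_form (x, y))%:E)%E); last first.
    by apply/funext => x /=; rewrite EFin_window_col.
  apply: (measurable_integral_fst (f := EFin \o window_form)).
    by apply/measurable_EFinP; exact: measurable_window_form.
  by move=> z; rewrite lee_fin window_form_ge0.
- by move=> y; rewrite ger0_norm ?window_col_le//; apply: Rintegral_ge0 => x _; exact: window_form_ge0.
- apply: (@integrable_mul_window_weight _ (`|m| + A)).
    by apply: measurable_funD => //; exact: measurable_cst.
  by move=> x; rewrite (le_trans (ler_normD _ _))// lerD2l.
Qed.

(** Integrate [window_row_ge], exchange the integrals, then apply [window_col_le]; the terms in [a]
    cancel. *)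
Lemma bilinear_window d L : 0 < d -> 0 < L -> L <= r ->
    (forall x, `|x| + L <= r -> \int[mu]_y (P x y * (1 - ind r y)) <= d) ->
  (l - m) * \int[mu]_x window_weight x <= C ^+ 2 * (2 * r * d + 2 * L * M).
Proof.
move=> d0 L0 Lr taud.
have ia k : mu.-integrable setT (EFin \o (fun x => (k + a x) * window_weight x)).
  apply: (@integrable_mul_window_weight _ (`|k| + A)).
    by apply: measurable_funD => //; exact: measurable_cst.
  by move=> x; rewrite (le_trans (ler_normD _ _))// lerD2l.
have M0 : 0 <= M by rewrite (le_trans _ (PM 0))// Rintegral_ge0.
(* The leak is at most [d] where [|x| <= r - L]; in the two boundary layers, of total length
   [2 * L], only the bound [M] is available. *)
pose E x := d * ind r x + (M * ind r x - M * ind (r - L) x).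
have iE : mu.-integrable setT (EFin \o E).
  apply: integrable_add; first exact: integrableZ_ind.
  by apply: integrable_sub; exact/integrableZ/integrable_ind.
have tauE x : ind r x * leak x <= E x.
  rewrite /E !indE; case: (leP `|x| r) => xr; last first.
    by have -> : `|x| <= r - L = false; [apply/negbTE; rewrite -ltNge (le_lt_trans _ xr)// gerBl ltW|rewrite !mulr0 mul0r subrr addr0].
  case: (leP `|x| (r - L)) => xrL /=; rewrite ?mul1r ?mulr1 ?mulr0 ?subr0 ?subrr ?addr0.
    by apply: taud; rewrite -lerBrDr.
  apply: (@le_trans _ _ M); last by rewrite lerDr ltW.
  apply: le_trans (PM x); apply: le_Rintegral => //; first exact: integrable_leak.
  move=> y _.
  by rewrite ler_piMr// gerBl ind_ge0.
have : \int[mu]_x ((l + a x) * window_weight x) <= \int[mu]_x (window_row x + C ^+ 2 * E x).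
  apply: le_Rintegral => //.
    apply: integrable_add => //.
      exact: integrable_window_row.
    exact/integrableZ.
  move=> x _; apply: (le_trans (window_row_ge x)).
  by rewrite lerD2l ler_wpM2l// sqr_ge0.
rewrite RintegralD//; [|exact: integrable_window_row|exact: integrableZ].
rewrite RintegralZl// window_tonelli.
have -> : \int[mu]_x E x = 2 * r * d + 2 * L * M.
  have iZ k s := integrableZ k (@integrable_ind R s).
  rewrite RintegralD//; last exact: integrable_sub.
  rewrite RintegralB//.
  rewrite !RintegralZl//; try exact: integrable_ind.
  by rewrite !Rintegral_ind ?subr_ge0//; ring.
have : \int[mu]_x window_col x <= \int[mu]_x ((m + a x) * window_weight x).
  by apply: le_Rintegral => //; [exact: integrable_window_col|move=> x _; exact: window_col_le].
have : (l - m) * \int[mu]_x window_weight x = \int[mu]_x ((l + a x) * window_weight x) - \int[mu]_x ((m + a x) * window_weight x).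
  rewrite -RintegralB// -RintegralZl//; last exact: integrable_window_weight.
  by apply: eq_Rintegral => x _; ring.
by move=> ->; rewrite lerBlDl => F'h lF; rewrite (le_trans lF)// lerD2r.
Qed.

Lemma Rintegral_window_weight_ge : c ^+ 2 * (2 * r) <= \int[mu]_x window_weight x.
Proof.
rewrite -Rintegral_ind// -RintegralZl//; last exact: integrable_ind.
apply: le_Rintegral => //; [exact: integrableZ_ind|exact: integrable_window_weight|by move=> x _; exact: window_weight_ge].
Qed.

End window.

(* Testing both inequalities against the indicator of a long window [-r, r]:
   the mass that P exchanges with the outside of the window is o(r). *)
Lemma bilinear_comparison : l <= m.
Proof.
apply: (@window_limit R l m c C M c0 window_bound_gt0).
  by rewrite (le_trans _ (PM 0))// Rintegral_ge0.
move=> ml d d0; have [L L0 tailL] := tailP d0.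
exists L => // r Lr; have r0 : 0 <= r by rewrite (le_trans (ltW L0)).
apply: le_trans (bilinear_window r0 d0 L0 Lr (fun x => tailL x r)).
by rewrite ler_wpM2l ?Rintegral_window_weight_ge// subr_ge0 ltW.
Qed.

End bilinear_comparison.

(** * Bounded uniformly continuous functions *)

Section buc.
Context {R : realType}.
Local Notation mu := (@lebesgue_measure R).

(** No sign is imposed, since this also has to describe logarithms; [admissibleP] relates it to
    [admissible]. *)
Definition buc (w : R -> R) : Prop :=
  (exists C, forall x, `|w x| <= C) /\
  (forall e, 0 < e -> exists2 r, 0 < r & forall x y, `|x - y| <= r -> `|w x - w y| <= e).

Lemma buc_continuous (w : R -> R) : buc w -> continuous w.
Proof.
move=> [_ uw] x; apply/cvgrPdist_le => e e0.
have [r r0 rw] := uw _ e0; near=> y; apply: rw.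
near: y; apply/nbhs_ballP; exists r => //= y; exact: ltW.
Unshelve. all: by end_near. Qed.

Lemma buc_measurable (w : R -> R) : buc w -> measurable_fun setT w.
Proof. by move=> /buc_continuous; exact: continuous_measurable_fun. Qed.

Lemma buc_expR (k : R) (w : R -> R) : buc w ->
  measurable_fun setT (fun x => expR (k * w x)) /\
  exists C, forall x, `|expR (k * w x)| <= C.
Proof.
move=> bw; split.
  have mkw : measurable_fun setT (fun x => k * w x).
    by apply: measurable_funM => //; exact: buc_measurable.
  exact: (measurableT_comp (@measurable_expR R) mkw).
have [[C wC] _] := bw; exists (expR (`|k| * C)) => x.
rewrite ger0_norm ?expR_ge0// ler_expR (le_trans (ler_norm _))// normrM ler_wpM2l//.
Qed.

End buc.

(** * The shifted positive operator and its logarithmic form *)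

Section positive_operator.
Context {R : realType}.
Local Notation mu := (@lebesgue_measure R).
Implicit Types (J : R -> R -> R) (b phi psi w : R -> R) (x s : R).

(** The integration variable is the offset [s = x - y]: rows of the kernel at different points are
    then compared at the same offset, and finite range is a condition on [s] alone. *)
Definition pop J phi x := \int[mu]_s (J x s * phi (x - s)).

Definition qop J b phi x := pop J phi x + b x * phi x.

Definition gop J b eps w x := ln (qop J b (fun y => expR ((1 - eps) * w y)) x).

(** The bound [1 <= b] gives [phi <= qop J b phi] for nonnegative [phi]: the logarithm in [gop] is
    then taken of a positive number, and errors proportional to [phi] can be absorbed into
    [qop J b phi]. *)
Record bounded_positive J b (M B : R) : Prop := BoundedPositive {
  J_ge0 : forall x s, 0 <= J x s ;
  J_int : forall x, mu.-integrable setT (EFin \o J x) ;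
  J_mass : forall x, \int[mu]_s J x s <= M ;
  b_ge1 : forall x, 1 <= b x ;
  b_le : forall x, b x <= B }.

Definition bmeas phi : Prop :=
  measurable_fun setT phi /\ exists C, forall x, `|phi x| <= C.

Lemma bmeas_subr phi x : bmeas phi ->
  measurable_fun setT (fun s : R => phi (x - s)).
Proof.
move=> [mphi _]; apply: (measurableT_comp mphi).
by apply: measurable_funB => //; exact: measurable_cst.
Qed.

Lemma bmeas_cst (c : R) : bmeas (cst c).
Proof. by split; [exact: measurable_cst|exists `|c|]. Qed.

Lemma pop_int J b M B phi x : bounded_positive J b M B -> bmeas phi ->
  mu.-integrable setT (EFin \o (fun s => J x s * phi (x - s))).
Proof.
move=> kJ bphi; have [_ [C phiC]] := bphi.
by apply: (integrable_mul_bounded (J_int kJ x) (bmeas_subr x bphi)) => s; exact: phiC.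
Qed.

Lemma pop_le J b M B phi psi c x : bounded_positive J b M B -> bmeas phi -> bmeas psi ->
  (forall s, phi (x - s) <= c * psi (x - s)) -> pop J phi x <= c * pop J psi x.
Proof.
move=> kJ bphi bpsi le; have iphi := pop_int x kJ bphi; have ipsi := pop_int x kJ bpsi.
rewrite /pop -RintegralZl//; apply: le_Rintegral => //; first exact: integrableZ.
by move=> s _; rewrite mulrCA ler_wpM2l// (J_ge0 kJ).
Qed.

Lemma qop_le J b M B phi psi c x : bounded_positive J b M B -> bmeas phi -> bmeas psi ->
  (forall y, phi y <= c * psi y) -> qop J b phi x <= c * qop J b psi x.
Proof.
move=> kJ bphi bpsi le; rewrite /qop mulrDr lerD//; first exact: (pop_le kJ).
by rewrite mulrCA ler_wpM2l// (le_trans ler01)// (b_ge1 kJ).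
Qed.

Lemma pop_ge0 J b M B phi x : bounded_positive J b M B -> (forall y, 0 <= phi y) ->
  0 <= pop J phi x.
Proof. by move=> kJ phi0; apply: Rintegral_ge0 => s _; rewrite mulr_ge0// (J_ge0 kJ). Qed.

Lemma qop_ge J b M B phi x : bounded_positive J b M B -> (forall y, 0 <= phi y) ->
  phi x <= qop J b phi x.
Proof.
move=> kJ phi0; rewrite /qop (le_trans (y := b x * phi x))//.
  by rewrite ler_peMl// (b_ge1 kJ).
by rewrite lerDr (pop_ge0 _ kJ).
Qed.

Lemma qop_cst1 J b x : qop J b (cst 1) x = \int[mu]_s J x s + b x.
Proof. by rewrite /qop /pop mulr1; congr (_ + _); apply: eq_Rintegral => s _; rewrite /= mulr1. Qed.

Lemma qop_cst1_le J b M B x : bounded_positive J b M B -> qop J b (cst 1) x <= M + B.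
Proof. by move=> kJ; rewrite qop_cst1 lerD// ?(J_mass kJ)// (b_le kJ). Qed.

Lemma bounded_positive_ge1 J b M B : bounded_positive J b M B -> 1 <= M + B.
Proof.
move=> kJ; rewrite (le_trans _ (qop_cst1_le 0 kJ))//.
by rewrite (le_trans _ (qop_ge 0 kJ (phi := cst 1) _)).
Qed.

Section gop_theory.
Context J b (M B : R).
Hypothesis kJ : bounded_positive J b M B.
Variable eps : R.
Hypothesis eps01 : 0 < eps < 1.

Definition ephi w := fun y => expR ((1 - eps) * w y).

Lemma ephi_bmeas w : buc w -> bmeas (ephi w).
Proof. exact: buc_expR. Qed.

Lemma ephi_gt0 w x : 0 < ephi w x.
Proof. exact: expR_gt0. Qed.

Lemma qop_ephi_gt0 w x : 0 < qop J b (ephi w) x.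
Proof.
rewrite (lt_le_trans (ephi_gt0 w x))//.
by apply: (qop_ge _ kJ) => y; rewrite ltW// ephi_gt0.
Qed.

Lemma expR_gop w x : expR (gop J b eps w x) = qop J b (ephi w) x.
Proof. by rewrite /gop lnK// posrE qop_ephi_gt0. Qed.

Lemma eps_ge0 : 0 <= 1 - eps.
Proof. by case/andP: eps01 => _ /ltW; rewrite subr_ge0. Qed.

Lemma gop_ge w x : (1 - eps) * w x <= gop J b eps w x.
Proof.
rewrite -ler_expR expR_gop; apply: (qop_ge _ kJ (phi := ephi w)) => y.
by rewrite ltW// ephi_gt0.
Qed.

(** [qop] is order preserving and homogeneous, so the factor [expR ((1 - eps) * d)] between the two
    arguments passes through it. *)
Lemma gop_contract w w' d : buc w -> buc w' -> (forall y, w y - w' y <= d) ->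
  forall x, gop J b eps w x - gop J b eps w' x <= (1 - eps) * d.
Proof.
move=> bw bw' wd x; rewrite lerBlDr -ler_expR expRD !expR_gop.
apply: (qop_le _ kJ); [exact: ephi_bmeas|exact: ephi_bmeas|move=> y].
by rewrite /ephi -expRD ler_expR -mulrDr ler_wpM2l ?eps_ge0// -lerBlDr.
Qed.

Lemma gop_le w C : buc w -> (forall y, w y <= C) ->
  forall x, gop J b eps w x <= (1 - eps) * C + ln (M + B).
Proof.
move=> bw wC x; rewrite -ler_expR expRD expR_gop lnK; last first.
  by rewrite posrE (lt_le_trans ltr01)// (bounded_positive_ge1 kJ).
apply: (@le_trans _ _ (expR ((1 - eps) * C) * qop J b (cst 1) x)).
  apply: (qop_le _ kJ); [exact: ephi_bmeas|exact: bmeas_cst|move=> y].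
  by rewrite mulr1 ler_expR ler_wpM2l ?eps_ge0.
by rewrite ler_wpM2l ?expR_ge0// qop_cst1_le.
Qed.

Definition ddist x x' := \int[mu]_s `|J x s - J x' s|.

(** The error made in [pop] when row [x'] of the kernel is replaced by row [x]. A bound by a
    multiple of [ephi w x'] turns it into an additive error for [gop]. *)
Definition edist w x x' := \int[mu]_s (`|J x s - J x' s| * ephi w (x' - s)).

Lemma J_diff_int x x' : mu.-integrable setT (EFin \o (fun s => `|J x s - J x' s|)).
Proof.
by apply: integrable_norm => //; apply: (integrable_sub (J_int kJ x) (J_int kJ x')).
Qed.

(** First replace [ephi w (x - s)] by [ephi w (x' - s)], at the cost of the factor
    [expR ((1 - eps) * d)], then the coefficients at [x] by those at [x']. The second error is a
    multiple of [ephi w x'], hence of [qop J b (ephi w) x'], and [1 + t <= expR t] makes it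
    additive. *)
Lemma gop_step w x x' d E : buc w ->
  (forall s, w (x - s) - w (x' - s) <= d) -> edist w x x' <= E * ephi w x' ->
  gop J b eps w x - gop J b eps w x' <= (1 - eps) * d + (E + `|b x - b x'|).
Proof.
move=> bw wd wE; rewrite lerBlDr -ler_expR expRD expRD !expR_gop.
have wd0 : w x - w x' <= d by have := wd 0; rewrite !subr0.
set k := expR ((1 - eps) * d); set phi := ephi w.
have bphi : bmeas phi := ephi_bmeas bw.
have k0 : 0 <= k by rewrite expR_ge0.
have kphi s : phi (x - s) <= k * phi (x' - s).
  by rewrite /phi /ephi -expRD ler_expR -mulrDr ler_wpM2l ?eps_ge0// -lerBlDr.
have phi'0 : 0 < phi x' by exact: ephi_gt0.
have E0 : 0 <= E.
  rewrite -(pmulr_lge0 _ phi'0) (le_trans _ wE)//; apply: Rintegral_ge0 => s _.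
  by rewrite mulr_ge0// ltW// ephi_gt0.
have q0 := qop_ephi_gt0 w x'.
have i1 : mu.-integrable setT (EFin \o (fun s => `|J x s - J x' s| * phi (x' - s))).
  have [_ [C phiC]] := bphi.
  by apply: (integrable_mul_bounded (J_diff_int x x') (bmeas_subr x' bphi)) => s; exact: phiC.
have P1 : pop J phi x <= k * (pop J phi x' + E * phi x').
  apply: (@le_trans _ _ (k * (pop J phi x' + edist w x x'))); last first.
    by rewrite ler_wpM2l// lerD2l.
  have i2 := pop_int x' kJ bphi.
  rewrite /pop /edist -RintegralD// -RintegralZl//; last exact: integrable_add.
  apply: le_Rintegral => //; first exact: (pop_int x kJ bphi).
    by apply: integrableZ; exact: integrable_add.
  move=> s _; rewrite -mulrDl mulrCA.
  apply: ler_pM; rewrite ?(J_ge0 kJ) ?(ltW (ephi_gt0 _ _))//.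
  by rewrite -lerBlDl ler_norm.
have P2 : b x * phi x <= k * ((b x' + `|b x - b x'|) * phi x').
  rewrite mulrCA; apply: ler_pM; rewrite ?(le_trans ler01 (b_ge1 kJ _))//.
  - by rewrite ltW// ephi_gt0.
  - by rewrite -lerBlDl ler_norm.
  - by have := kphi 0; rewrite !subr0.
have P3 : qop J b phi x <= k * (qop J b phi x' + (E + `|b x - b x'|) * phi x').
  rewrite {1}/qop (le_trans (lerD P1 P2))// -mulrDr ler_wpM2l// /qop.
  by rewrite le_eqVlt; apply/orP; left; apply/eqP; ring.
apply: (le_trans P3); rewrite -mulrA ler_wpM2l//.
apply: (@le_trans _ _ (qop J b phi x' * (1 + (E + `|b x - b x'|)))); last first.
  by rewrite mulrC ler_wpM2r ?expR_ge1Dx// ltW.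
rewrite mulrDr mulr1 lerD2l mulrC ler_wpM2r ?addr_ge0//.
by apply: (qop_ge _ kJ) => y; rewrite ltW// ephi_gt0.
Qed.

End gop_theory.
End positive_operator.

(** * Almost fixed points of the contraction *)

Section approximate_fixed_point.
Context {R : realType}.
Local Notation mu := (@lebesgue_measure R).
Implicit Types (J : R -> R -> R) (b w : R -> R) (x : R).

Definition kernel_uc J b : Prop := forall d, 0 < d -> exists2 r, 0 < r &
  forall x x', `|x - x'| <= r -> ddist J x x' <= d /\ `|b x - b x'| <= d.

Lemma ephi_bounds (eps C : R) w : 0 < eps < 1 -> (forall x, `|w x| <= C) ->
  forall x, expR (- C) <= ephi eps w x <= expR C.
Proof.
move=> /andP[e0 e1] wC x; rewrite /ephi !ler_expR -ler_norml normrM.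
rewrite (le_trans _ (wC x))// ler_piMl// ger0_norm ?subr_ge0 ?(ltW e1)//.
by rewrite gerBl ltW.
Qed.

(** A crude bound from the extreme values of [ephi]. Its constant depends on [w], which is harmless
    for showing that [gop] preserves [buc]; estimates uniform in [eps] rest on
    [comparable_on_support] instead. *)
Lemma edist_le J b M B (eps C : R) w x x' : bounded_positive J b M B ->
  0 < eps < 1 -> buc w -> (forall x, `|w x| <= C) ->
  edist J eps w x x' <= expR (2 * C) * ddist J x x' * ephi eps w x'.
Proof.
move=> kJ e01 bw wC; have phiC := ephi_bounds e01 wC.
have i1 := J_diff_int kJ x x'; have [_ [C' phiC']] := ephi_bmeas eps bw.
have dd0 : 0 <= ddist J x x' by exact: Rintegral_ge0.
apply: (@le_trans _ _ (expR C * ddist J x x')); last first.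
  have -> : expR C = expR (2 * C) * expR (- C) by rewrite -expRD; congr expR; ring.
  rewrite -!mulrA ler_wpM2l ?expR_ge0// mulrC ler_wpM2l//.
  by case/andP : (phiC x').
rewrite /edist /ddist -RintegralZl//; apply: le_Rintegral => //.
- apply: (integrable_mul_bounded i1 (bmeas_subr x' (ephi_bmeas eps bw))) => s.
  exact: phiC'.
- exact: integrableZ.
- by move=> s _; rewrite mulrC ler_wpM2r//; case/andP : (phiC (x' - s)).
Qed.

Lemma gop_buc J b M B eps w : bounded_positive J b M B -> kernel_uc J b ->
  0 < eps < 1 -> buc w -> buc (gop J b eps w).
Proof.
move=> kJ uJ e01 bw; have [[C wC] uw] := bw.
have e1 : 0 <= 1 - eps by case/andP : e01 => _ /ltW; rewrite subr_ge0.
have e1' : 1 - eps <= 1 by case/andP : e01 => /ltW e0 _; rewrite gerBl.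
have C0 : 0 <= C by rewrite (le_trans _ (wC 0)).
have B0 : 0 <= ln (M + B) by rewrite ln_ge0// (bounded_positive_ge1 kJ).
split.
  exists (C + ln (M + B)) => x; rewrite ler_norml; apply/andP; split.
    apply: le_trans (gop_ge kJ eps w x).
    have : - C <= (1 - eps) * w x.
      rewrite lerNl -mulrN (le_trans (ler_norm _))// normrM normrN (le_trans _ (wC x))//.
      by rewrite ler_piMl// ger0_norm.
    by move=> H; apply: le_trans H; rewrite lerN2 lerDl.
  apply: (le_trans (gop_le kJ e01 bw (C := C) _ x)).
    by move=> y; rewrite (le_trans (ler_norm _)).
  by rewrite lerD2r ler_piMl.
move=> e e0; have k1 : 1 <= expR (2 * C) by rewrite -expR0 ler_expR mulr_ge0.
have k0 : 0 < expR (2 * C) by exact: expR_gt0.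
have [|r1 r10 ur1] := uw (e / 3); first by rewrite divr_gt0.
have [|r2 r20 ur2] := uJ (e / 3 / expR (2 * C)); first by rewrite !divr_gt0.
exists (Num.min r1 r2) => [|x x']; first by rewrite lt_min r10.
rewrite le_min => /andP[xr1 xr2].
have one_sided y y' : `|y - y'| <= r1 -> `|y - y'| <= r2 ->
    gop J b eps w y - gop J b eps w y' <= e.
  move=> yr1 yr2; have [D1 D2] := ur2 _ _ yr2.
  apply: (@le_trans _ _ ((1 - eps) * (e / 3) + (expR (2 * C) * ddist J y y' + `|b y - b y'|))).
    apply: (gop_step kJ e01 bw); last exact: (edist_le _ _ kJ e01 bw wC).
    move=> s; rewrite (le_trans (ler_norm _))// ur1//.
    by rewrite (_ : y - s - (y' - s) = y - y')//; ring.
  have H1 : (1 - eps) * (e / 3) <= e / 3 by rewrite ler_piMl// ltW// divr_gt0.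
  have H2 : expR (2 * C) * ddist J y y' <= e / 3.
    by move: D1; rewrite ler_pdivlMr// mulrC.
  have H3 : `|b y - b y'| <= e / 3.
    apply: (le_trans D2); rewrite ler_pdivrMr// ler_peMr// ltW// divr_gt0//.
  lra.
rewrite ler_norml lerNl opprB; apply/andP; split; apply: one_sided => //; by rewrite distrC.
Qed.

(** Iterate from 0: consecutive iterates differ by at most [(1 - eps) ^+ n * ln (M + B)], so a late
    enough iterate already serves and no limit has to be taken. *)
Lemma approximate_fixed_point J b M B eps eta : bounded_positive J b M B ->
    kernel_uc J b -> 0 < eps < 1 -> 0 < eta ->
  exists2 w, buc w & forall x, 0 <= eps * w x <= ln (M + B) /\
    `|gop J b eps w x - w x| <= eta.
Proof.
move=> kJ uJ e01 eta0; have /andP[e0 e1] := e01.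
have e1' : 0 <= 1 - eps by rewrite subr_ge0 ltW.
have B0 : 0 <= ln (M + B) by rewrite ln_ge0// (bounded_positive_ge1 kJ).
pose w n := iter n (gop J b eps) (cst 0).
have bw n : buc (w n).
  elim: n => [|n IH]; last exact: (gop_buc kJ).
  by split; [exists 0 => x; rewrite normr0|move=> e he; exists 1 => // x y _; rewrite subrr normr0 ltW].
have w0 n x : 0 <= w n x.
  elim: n x => [//|n IH] x; apply: le_trans (gop_ge kJ eps (w n) x).
  by rewrite mulr_ge0.
(* By [gop_le] an upper bound [C] becomes [(1 - eps) * C + ln (M + B)], and [ln (M + B) / eps] is
   the fixed point of this map. *)
have wB n x : eps * w n x <= ln (M + B).
  elim: n x => [|n IH] x; first by rewrite mulr0.
  have wle y : w n y <= ln (M + B) / eps by rewrite ler_pdivlMr// mulrC.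
  have := gop_le kJ e01 (bw n) wle x; rewrite -[gop _ _ _ _ _]/(w n.+1 x) => H.
  rewrite -ler_pdivlMl//; apply: (le_trans H).
  rewrite le_eqVlt; apply/orP; left; apply/eqP; field; exact: lt0r_neq0.
have wS n x : `|w n.+1 x - w n x| <= (1 - eps) ^+ n * ln (M + B).
  elim: n x => [|n IH] x.
    rewrite subr0 expr0 mul1r ger0_norm//.
    by have := gop_le kJ e01 (bw 0) (C := 0) (fun=> lexx _) x; rewrite mulr0 add0r.
  have H1 y : w n.+1 y - w n y <= (1 - eps) ^+ n * ln (M + B).
    by rewrite (le_trans (ler_norm _)).
  have H2 y : w n y - w n.+1 y <= (1 - eps) ^+ n * ln (M + B).
    by rewrite (le_trans (ler_norm _))// distrC.
  rewrite exprS -mulrA ler_norml lerNl opprB; apply/andP; split.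
    exact: (gop_contract kJ e01 (bw _) (bw _) H2).
  exact: (gop_contract kJ e01 (bw _) (bw _) H1).
have [n Hn] : exists n, (1 - eps) ^+ n * ln (M + B) <= eta.
  have : (1 - eps) ^+ n * ln (M + B) @[n --> \oo] --> (0 : R).
    rewrite -[X in _ --> X](mul0r (ln (M + B))); apply: cvgMl.
    by apply: cvg_expr; rewrite ger0_norm// gtrBl.
  move=> /cvgrPdist_le/(_ _ eta0)[n _ Hn]; exists n.
  by have := Hn n (leqnn n); rewrite sub0r normrN; exact: le_trans (ler_norm _).
exists (w n) => // x; split; first by rewrite wB mulr_ge0// ltW.
by apply: le_trans (wS n x) Hn.
Qed.

End approximate_fixed_point.

(** * Oscillation of almost fixed points *)

Section oscillation.
Context {R : realType}.
Local Notation mu := (@lebesgue_measure R).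
Implicit Types (J : R -> R -> R) (b w v : R -> R) (x : R).

Definition translates_close J b d t t' : Prop :=
  forall x, ddist J (x + t) (x + t') <= d /\ `|b (x + t) - b (x + t')| <= d.

Lemma translates_close_sym J b d t t' :
  translates_close J b d t t' -> translates_close J b d t' t.
Proof.
move=> cl x; have [] := cl x; rewrite (distrC (b _)); split => //.
rewrite (_ : ddist _ _ _ = ddist J (x + t) (x + t'))//.
by apply: eq_Rintegral => s _; rewrite distrC.
Qed.

(** Let [S] be the supremum of [w (x + t) - w (x + t')] over [x]. Applying [gop_step] at all points
    gives [S <= (1 - eps) * S + (H + 1) * d + 2 * eta], which bounds [eps * S] by a quantity free of
    [eps]. *)
Lemma translation_estimate J b M B eps w eta H d t t' :
    bounded_positive J b M B -> 0 < eps < 1 -> buc w ->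
    (forall x, `|gop J b eps w x - w x| <= eta) -> 0 <= H ->
    (forall x x', edist J eps w x x' <= H * ddist J x x' * ephi eps w x') ->
    translates_close J b d t t' ->
  forall x, eps * w (x + t) - eps * w (x + t') <= (H + 1) * d + 2 * eta.
Proof.
move=> kJ e01 bw wfix H0 flat cl x; have [[C wC] _] := bw.
pose D := [set w (x + t) - w (x + t') | x in setT].
have D0 : D !=set0 by exists (w (0 + t) - w (0 + t')); exists 0.
have ubD : has_ubound D.
  exists (C + C) => _ [y _ <-]; rewrite lerD// ?(le_trans (ler_norm _) (wC _))//.
  by rewrite (le_trans (ler_norm _))// normrN.
have leS y : w (y + t) - w (y + t') <= sup D by apply: ub_le_sup => //; exists y.
have e1 : 0 <= 1 - eps by case/andP : e01 => _ /ltW; rewrite subr_ge0.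
have HS : sup D <= (1 - eps) * sup D + (H * d + d) + 2 * eta.
  apply: ge_sup => // _ [y _ <-].
  have [cl1 cl2] := cl y.
  have st : gop J b eps w (y + t) - gop J b eps w (y + t') <= (1 - eps) * sup D + (H * d + d).
    apply: le_trans (gop_step kJ e01 bw (d := sup D) (E := H * ddist J (y + t) (y + t')) _ _) _ => //.
      by move=> s; rewrite (addrAC y t) (addrAC y t').
    by rewrite lerD2l lerD// ler_wpM2l.
  have := wfix (y + t); have := wfix (y + t').
  by rewrite !ler_norml => /andP[? ?] /andP[? ?]; lra.
have e0 : 0 <= eps by case/andP : e01 => /ltW.
have := leS x; rewrite -subr_ge0 => /(mulr_ge0 e0); rewrite !mulrBr mulrBl mul1r in HS *.
lra.
Qed.

(** Keep in [qop] at [x] only the contribution of the interval of radius [rho] about [y], where the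
    kernel is at least [theta]. This gives [w x >= ln (2 * rho * theta) + (1 - eps) * (w y - om /
    eps) - eta]. After multiplication by [eps] the constants carry a factor [eps], and so does the
    loss [eps * (eps * w y)], because [eps * w y <= ln (M + B)]. *)
Lemma local_lower_bound J b M B eps w eta theta Delta rho om x y :
    bounded_positive J b M B -> 0 < eps < 1 -> buc w ->
    (forall x, `|gop J b eps w x - w x| <= eta) ->
    (forall x, 0 <= eps * w x <= ln (M + B)) ->
    0 < theta -> (forall x s, `|s| <= Delta -> theta <= J x s) ->
    0 < rho -> rho <= Delta / 2 -> 0 <= om ->
    (forall z, `|z - y| <= rho -> eps * w y - om <= eps * w z) ->
    `|x - y| <= Delta / 2 ->
  eps * w y - (om + eps * (ln (M + B) + `|ln (2 * rho * theta)| + eta)) <= eps * w x.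
Proof.
move=> kJ e01 bw wfix wB th0 Jth rho0 rhoD om0 wom xy.
have /andP[e0 e1] := e01; have e1' : 0 <= 1 - eps by rewrite subr_ge0 ltW.
pose l := (1 - eps) * (w y - om / eps).
have near_y z : `|z - y| <= rho -> expR l <= ephi eps w z.
  move=> zy; rewrite ler_expR ler_wpM2l// -(ler_pM2l e0) mulrBr mulrCA divff ?gt_eqF// mulr1.
  exact: wom.
have p0 : 0 < 2 * rho * theta by rewrite !mulr_gt0.
have lepop : 2 * rho * theta * expR l <= pop J (ephi eps w) x.
  have -> : 2 * rho * theta * expR l = \int[mu]_s (theta * expR l * ind rho (x - y - s)).
    rewrite RintegralZl//; last exact/integrable_subr/integrable_ind.
    rewrite (Rintegral_subr (x - y) (integrable_ind rho)) Rintegral_ind 1?ltW//; ring.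
  apply: le_Rintegral => //.
    exact/integrableZ/integrable_subr/integrable_ind.
    exact: (pop_int x kJ (ephi_bmeas eps bw)).
  move=> s _; rewrite indE; case: (leP _ rho) => [xys|_]; last first.
    by rewrite mulr0 mulr_ge0// ?(J_ge0 kJ)// ltW// ephi_gt0.
  rewrite mulr1; apply: ler_pM; rewrite ?(ltW th0) ?expR_ge0//.
    apply: Jth; rewrite (_ : s = (x - y) - (x - y - s)); last by ring.
    rewrite (le_trans (ler_normB _ _))// (splitr Delta) lerD//.
    exact: le_trans rhoD.
  by apply: near_y; rewrite (_ : x - s - y = x - y - s)//; ring.
have leg : ln (2 * rho * theta) + l <= gop J b eps w x.
  rewrite -ler_expR expRD lnK ?posrE// (expR_gop kJ).
  apply: (le_trans lepop); rewrite /qop lerDl mulr_ge0//.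
    exact: le_trans (b_ge1 kJ x).
  by rewrite ltW// ephi_gt0.
have wx : ln (2 * rho * theta) + l - eta <= w x.
  by have := wfix x; rewrite ler_norml => /andP[_]; lra.
have /andP[y0 yB] := wB y.
have ewx : eps * ln (2 * rho * theta) + (1 - eps) * (eps * w y - om) - eps * eta <= eps * w x.
  rewrite -(ler_pM2l e0) in wx; apply: le_trans wx.
  rewrite le_eqVlt; apply/orP; left; apply/eqP; rewrite /l; field; exact: lt0r_neq0.
apply: le_trans ewx; set L := ln (2 * rho * theta); set B0 := ln (M + B).
have h1 : 0 <= eps * (L + `|L|).
  by rewrite mulr_ge0 ?(ltW e0)//; have := ler_norm (- L); rewrite normrN; lra.
have h2 : 0 <= eps * (B0 - eps * w y) by rewrite mulr_ge0 ?(ltW e0)// subr_ge0.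
have h3 : 0 <= eps * om by rewrite mulr_ge0 ?(ltW e0).
rewrite -subr_ge0.
have -> : eps * L + (1 - eps) * (eps * w y - om) - eps * eta - (eps * w y - (om + eps * (B0 + `|L| + eta))) = eps * (L + `|L|) + eps * (B0 - eps * w y) + eps * om by ring.
by rewrite !addr_ge0.
Qed.

(** Go from [x] to [y] in [n] equal steps, each of length at most [h] and losing at most [xi]. *)
Lemma chain_lower_bound v (h xi : R) :
    (forall x y, `|x - y| <= h -> v y - xi <= v x) ->
  forall n x y, `|x - y| <= n%:R * h -> v y - n%:R * xi <= v x.
Proof.
move=> loc; elim=> [|n IH] x y.
  by rewrite !mul0r normr_le0 subr_eq0 subr0 => /eqP ->.
move=> xy; pose z := x + (y - x) / n.+1%:R.
have n0 : 0 < n.+1%:R :> R by rewrite ltr0n.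
have xz : `|x - z| <= h.
  rewrite (_ : x - z = (x - y) / n.+1%:R); last by rewrite /z; field; rewrite nat1r pnatr_eq0.
  by rewrite normrM normfV (ger0_norm (ltW n0)) ler_pdivrMr// mulrC.
have zy : `|z - y| <= n%:R * h.
  rewrite (_ : z - y = n%:R * ((x - y) / n.+1%:R)); last first.
    by rewrite /z -natr1; field; rewrite natr1 pnatr_eq0.
  rewrite normrM normrM normfV (ger0_norm (ltW n0)) ger0_norm// ler_wpM2l//.
  by rewrite ler_pdivrMr// mulrC.
have := IH _ _ zy; have := loc _ _ xz; rewrite -(natr1 n) mulrDl mul1r; lra.
Qed.

End oscillation.

(** * Quasi-eigenfunctions from small oscillation *)

Section quasi_eigenfunction.
Context {R : realType}.
Implicit Types (J : R -> R -> R) (b w phi : R -> R) (x : R).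

(** Bohr's relative density of almost periods, for [J] and [b] jointly: [t - t'] is an almost period
    within [R0] of [t]. *)
Definition relatively_dense_translates J b : Prop := forall d, 0 < d ->
  exists R0, forall t, exists2 t', `|t'| <= R0 & translates_close J b d t t'.

(* [H * phi x'] bounds [phi (x' - s)] wherever [J x s - J x' s] is nonzero. *)
Definition comparable_on_support J b S H eta0 : Prop := forall eps w,
  0 < eps < 1 -> buc w -> (forall x, eps * w x <= ln S) ->
  (forall x, `|gop J b eps w x - w x| <= eta0) ->
  forall x x', edist J eps w x x' <= H * ddist J x x' * ephi eps w x'.

(** The order of the choices matters. As [H] and [eta0] serve all [eps] and [w], the tolerance [d1]
    fixes the radius [R0], this fixes the number [N] of chain steps, then come [d2] and [rho], and
    only at the end [eta] and [eps], small relative to [1 / N]. *)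
Lemma small_oscillation J b M B theta Delta H eta0 d : bounded_positive J b M B ->
    kernel_uc J b -> 0 < theta -> 0 < Delta ->
    (forall x s, `|s| <= Delta -> theta <= J x s) ->
    relatively_dense_translates J b ->
    0 <= H -> 0 < eta0 -> comparable_on_support J b (M + B) H eta0 -> 0 < d ->
  exists eps w, [/\ 0 < eps < 1, buc w, forall x, 0 <= eps * w x <= ln (M + B),
    forall x, `|gop J b eps w x - w x| <= d &
    forall x y, eps * w y - d <= eps * w x].
Proof.
move=> kJ uJ th0 D0 Jth dense H0 eta00 flat d0.
have B0 : 0 <= ln (M + B) by rewrite ln_ge0// (bounded_positive_ge1 kJ).
have H1 : 0 < H + 1 by rewrite ltr_wpDl.
pose d1 := d / 8 / (H + 1).
have d10 : 0 < d1 by rewrite !divr_gt0.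
have [R0 dense0] := dense _ d10.
(* Enough steps of length [Delta / 2] to cross [[- R0, R0]]. The absolute value is there because
   [R0] carries no sign; the successor makes [N] positive. *)
pose N := (Num.bound (4 * `|R0| / Delta)).+1.
have N1 : 1 <= N%:R :> R by rewrite ler1n.
have N0 : 0 < N%:R :> R by rewrite ltr0n.
have RN : R0 + R0 <= N%:R * (Delta / 2).
  have : 4 * `|R0| / Delta <= N%:R.
    rewrite ltW// (lt_trans (archi_boundP _))//; last by rewrite ltr_nat.
    by apply: divr_ge0; [exact: mulr_ge0|exact: ltW].
  rewrite ler_pdivrMr//; have := ler_norm R0; lra.
pose d2 := d1 / N%:R.
have d20 : 0 < d2 by rewrite divr_gt0.
have [r r0 ur] := uJ _ d20.
pose rho := Num.min r (Delta / 2).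
have rho0 : 0 < rho by rewrite lt_min r0 divr_gt0.
have rhoD : rho <= Delta / 2 by rewrite ge_min lexx orbT.
pose Z := ln (M + B) + `|ln (2 * rho * theta)| + 1.
have Z0 : 0 < Z by rewrite ltr_wpDl// addr_ge0.
pose eta := Num.min (Num.min eta0 1) (d / 32 / N%:R).
have eta_gt0 : 0 < eta by rewrite !lt_min eta00 ltr01 !divr_gt0.
have eta_le0 : eta <= eta0 by rewrite !ge_min lexx.
have eta_le1 : eta <= 1 by rewrite !ge_min lexx orbT.
have Neta : N%:R * eta <= d / 32.
  by rewrite mulrC -ler_pdivlMr// !ge_min lexx orbT.
have eta_d : eta <= d / 32.
  by apply: le_trans Neta; rewrite ler_peMl// ltW.
pose eps := Num.min 2^-1 (d / 4 / (N%:R * Z)).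
have eps0 : 0 < eps by rewrite lt_min invr_gt0 ltr0n/= !divr_gt0// mulr_gt0.
have e01 : 0 < eps < 1 by rewrite eps0 gt_min invf_lt1// ltr1n.
have NZ : eps * (N%:R * Z) <= d / 4.
  by rewrite -ler_pdivlMr ?mulr_gt0// ge_min lexx orbT.
have [w bw wfix'] := approximate_fixed_point kJ uJ e01 eta_gt0.
have wB x := (wfix' x).1; have wfix x := (wfix' x).2.
have wflat : forall x x', edist J eps w x x' <= H * ddist J x x' * ephi eps w x'.
  by apply: flat => // x; [case/andP : (wB x)|apply: le_trans eta_le0].
have transl t t' e : translates_close J b e t t' ->
    eps * w t - eps * w t' <= (H + 1) * e + 2 * eta.
  by move=> cl; have := translation_estimate kJ e01 bw wfix H0 wflat cl 0; rewrite !add0r.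
have Hd1 : (H + 1) * d1 = d / 8 by rewrite /d1; field; exact: lt0r_neq0.
have Hd2 : N%:R * ((H + 1) * d2) = d / 8.
  by rewrite /d2 /d1; field; rewrite !lt0r_neq0.
pose om := (H + 1) * d2 + 2 * eta.
have om0 : 0 <= om by rewrite addr_ge0// ltW// mulr_gt0.
pose xi := om + eps * (ln (M + B) + `|ln (2 * rho * theta)| + eta).
(* For [z] within [rho] of [y], uniform continuity of the coefficients makes the translates by [y]
   and [z] close, so [transl] supplies the modulus [om] that [local_lower_bound] requires. *)
have loc x y : `|x - y| <= Delta / 2 -> eps * w y - xi <= eps * w x.
  move=> xy; apply: (local_lower_bound kJ e01 bw wfix wB th0 Jth rho0 rhoD om0 _ xy) => z zy.
  have /transl : translates_close J b d2 y z.
    move=> u; apply: ur; rewrite (_ : u + y - (u + z) = y - z); last by ring.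
    by rewrite distrC (le_trans zy)// ge_min lexx.
  by rewrite -/om; lra.
have Nxi : N%:R * xi <= d / 8 + d / 16 + d / 4.
  have -> : N%:R * xi = N%:R * ((H + 1) * d2) + 2 * (N%:R * eta) +
    eps * (N%:R * (ln (M + B) + `|ln (2 * rho * theta)| + eta)) by rewrite /xi /om; ring.
  rewrite Hd2 lerD// ?lerD//; first by lra.
  by apply: le_trans NZ; rewrite ler_wpM2l ?(ltW eps0)// ler_wpM2l ?(ltW N0)// /Z lerD2l.
exists eps, w; split => //.
  by move=> x; rewrite (le_trans (wfix x))// (le_trans eta_d)//; lra.
(* Move [x] and [y] to [x'] and [y'] in [[- R0, R0]], at a cost of at most [3 * d / 16] each, and
   join these by the chain, which costs at most [7 * d / 16]. *)
move=> x y; have [x' x'R clx] := dense0 x; have [y' y'R cly] := dense0 y.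
have := transl _ _ _ (translates_close_sym clx); have := transl _ _ _ cly.
have x'y' : `|x' - y'| <= N%:R * (Delta / 2).
  by rewrite (le_trans (ler_normB _ _))// (le_trans _ RN)// lerD.
have := chain_lower_bound (v := fun x => eps * w x) loc x'y'.
rewrite Hd1 => h1 h2 h3; lra.
Qed.

Lemma expR_lip (u v C : R) : u <= C -> v <= C -> `|expR u - expR v| <= expR C * `|u - v|.
Proof.
have one (s t : R) : s <= C -> expR s - expR t <= expR C * `|s - t|.
  move=> sC; have -> : expR s - expR t = expR s * (1 - expR (t - s)).
    by rewrite mulrBr mulr1 -expRD [s + _]addrC subrK.
  apply: (@le_trans _ _ (expR s * `|s - t|)); last by rewrite ler_wpM2r// ler_expR.
  rewrite ler_wpM2l ?expR_ge0//; have := expR_ge1Dx (t - s); have := ler_norm (s - t); lra.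
move=> uC vC; rewrite ler_norml lerNl opprB; apply/andP; split; last exact: one.
by rewrite distrC; exact: one.
Qed.

Lemma ephi_buc eps w : 0 < eps < 1 -> buc w -> buc (ephi eps w).
Proof.
move=> e01 bw; have [_ bphi] := ephi_bmeas eps bw; split => //.
have [[C wC] uw] := bw => e e0.
have [r r0 ur] := uw (e / expR C) (divr_gt0 e0 (expR_gt0 C)).
have /andP[eps0 eps1] := e01.
have e1 : 0 <= 1 - eps by rewrite subr_ge0 ltW.
have e1' : 1 - eps <= 1 by rewrite gerBl ltW.
have wC' x : (1 - eps) * w x <= C.
  rewrite (le_trans (ler_norm _))// normrM ger0_norm// (le_trans _ (wC x))//.
  by rewrite ler_piMl.
exists r => // x y xy; apply: (le_trans (expR_lip (wC' x) (wC' y))).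
have := ur _ _ xy; rewrite ler_pdivlMr ?expR_gt0// mulrC => H.
apply: le_trans H; rewrite ler_wpM2l ?expR_ge0// -mulrBr normrM ger0_norm//.
by rewrite ler_piMl.
Qed.

Lemma expR_gap (u : R) : 0 <= u -> u <= 2^-1 -> expR u - expR (- u) <= 4 * u.
Proof.
move=> u0 u1; have h1 : 1 - u <= expR (- u) by exact: expR_ge1Dx.
have p : 0 < 1 - u by lra.
have h2 : expR u <= (1 - u)^-1.
  by rewrite -(invrK (expR u)) -expRN lef_pV2// posrE expR_gt0.
have h3 : (1 - u)^-1 <= 1 + 3 * u.
  rewrite -div1r ler_pdivrMr//.
  have -> : (1 + 3 * u) * (1 - u) = 1 + u * (2 - 3 * u) by ring.
  by rewrite lerDl mulr_ge0//; lra.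
lra.
Qed.

(** For [phi = ephi eps w] the quotient [qop J b phi / phi] is
    [expR (gop J b eps w - (1 - eps) * w)]. Its exponent is within [d] of [eps * w], which is within
    [d] of its value at 0. *)
Lemma quasi_eigenfunction J b M B theta Delta H eta0 delta : bounded_positive J b M B ->
    kernel_uc J b -> 0 < theta -> 0 < Delta ->
    (forall x s, `|s| <= Delta -> theta <= J x s) ->
    relatively_dense_translates J b ->
    0 <= H -> 0 < eta0 -> comparable_on_support J b (M + B) H eta0 -> 0 < delta ->
  exists phi l, [/\ buc phi, exists2 c, 0 < c & forall x, c <= phi x,
    forall x, l * phi x <= qop J b phi x &
    forall x, qop J b phi x <= (l + delta) * phi x].
Proof.
move=> kJ uJ th0 D0 Jth dense H0 eta00 flat delta0.
have MB1 := bounded_positive_ge1 kJ; have MB0 : 0 < M + B by lra.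
(* The bound [4^-1] lets [expR_gap] apply to [2 * d]; the other one makes the resulting gap
   [(M + B) * (8 * d)] at most [delta]. *)
pose d := Num.min 4^-1 (delta / 8 / (M + B)).
have d0 : 0 < d by rewrite lt_min invr_gt0 ltr0n/= !divr_gt0.
have [eps [w [e01 bw wB wfix osc]]] := small_oscillation kJ uJ th0 D0 Jth dense H0 eta00 flat d0.
have [[C wC] _] := bw.
pose v0 := eps * w 0.
exists (ephi eps w), (expR (v0 - 2 * d)); split.
- exact: ephi_buc.
- exists (expR (- C)); first exact: expR_gt0.
  by move=> x; case/andP : (ephi_bounds e01 wC x).
- move=> x; rewrite -(expR_gop kJ) /ephi -expRD ler_expR.
  have := osc x 0; have := wfix x; rewrite ler_norml => /andP[] ? ?.
  rewrite /v0; lra.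
- move=> x; apply: (@le_trans _ _ (expR (v0 + 2 * d) * ephi eps w x)).
    rewrite -(expR_gop kJ) /ephi -expRD ler_expR.
    have := osc 0 x; have := wfix x; rewrite ler_norml => /andP[] ? ?.
    rewrite /v0; lra.
  rewrite ler_wpM2r ?(ltW (ephi_gt0 _ _ _))// -lerBlDl.
  have -> : expR (v0 + 2 * d) - expR (v0 - 2 * d) = expR v0 * (expR (2 * d) - expR (- (2 * d))).
    by rewrite mulrBr !expRD.
  have d4 : d <= 4^-1 by rewrite ge_min lexx.
  have gap : expR (2 * d) - expR (- (2 * d)) <= 8 * d.
    by have := @expR_gap (2 * d); rewrite mulrA -natrM; apply; lra.
  have v0B : expR v0 <= M + B.
    rewrite -[leRHS]lnK ?posrE// ler_expR; by case/andP : (wB 0).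
  apply: (@le_trans _ _ ((M + B) * (8 * d))).
    apply: ler_pM => //; rewrite ?expR_ge0// subr_ge0 ler_expR; lra.
  have : d <= delta / 8 / (M + B) by rewrite ge_min lexx orbT.
  rewrite ler_pdivlMr//; lra.
Qed.

End quasi_eigenfunction.

(** * A Harnack inequality for kernels of finite range *)

Section harnack.
Context {R : realType}.
Local Notation mu := (@lebesgue_measure R).
Implicit Types (J : R -> R -> R) (b w phi : R -> R) (x z u : R).

Definition wint phi r x := \int[mu]_y (phi y * ind r (x - y)).

Lemma wint_int phi r x : bmeas phi ->
  mu.-integrable setT (EFin \o (fun y => phi y * ind r (x - y))).
Proof.
move=> [mphi [C phiC]].
have := integrable_mul_bounded (integrable_subr x (integrable_ind r)) mphi phiC.
by apply: eq_integrable => // y _ /=; rewrite mulrC.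
Qed.

(** The interval of radius [r] about [z] covers the right half of the larger interval and the one
    about [z'] the left half; [2 * h <= r] makes both reach [x]. *)
Lemma wint_cover phi r h x z z' : bmeas phi -> (forall y, 0 <= phi y) ->
  2 * h <= r -> h <= z - x <= 2 * h -> h <= x - z' <= 2 * h ->
  wint phi (r + h) x <= wint phi r z + wint phi r z'.
Proof.
move=> bphi phi0 hr /andP[z1 z2] /andP[z'1 z'2].
have i1 := wint_int r z bphi; have i2 := wint_int r z' bphi.
rewrite /wint -RintegralD//; apply: le_Rintegral => //; first exact: wint_int.
  exact: integrable_add.
move=> y _; rewrite -mulrDr ler_wpM2l// !indE.
case: (leP `|x - y| (r + h)) => [|_]; last by rewrite addr_ge0.
rewrite ler_norml => /andP[y1 y2]; have [xy|yx] := leP x y.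
  rewrite (_ : (`|z - y| <= r)%R = true) ?lerDl//.
  by rewrite ler_norml; apply/andP; split; lra.
rewrite (_ : (`|z' - y| <= r)%R = true) ?lerDr//.
by rewrite ler_norml; apply/andP; split; lra.
Qed.

Lemma pop_ge_window J b M B phi theta Delta g c r x : bounded_positive J b M B ->
    bmeas phi -> (forall y, 0 <= phi y) -> 0 <= theta -> 0 <= g -> 0 <= r ->
    (forall s, `|s| <= Delta -> theta <= J x s) -> `|c| + r <= Delta ->
    (forall s, `|c - s| <= r -> g <= phi (x - s)) ->
  theta * g * (2 * r) <= pop J phi x.
Proof.
move=> kJ bphi phi0 th0 g0 r0 Jth cr phig.
rewrite -(Rintegral_ind r0) -(Rintegral_subr c (integrable_ind r)) -RintegralZl//; last first.
  exact/integrable_subr/integrable_ind.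
apply: le_Rintegral => //; first exact/integrableZ/integrable_subr/integrable_ind.
  exact: (pop_int x kJ bphi).
move=> s _; rewrite indE; case: (leP _ r) => [cs|_]; last first.
  by rewrite mulr0 mulr_ge0// (J_ge0 kJ).
rewrite mulr1; apply: ler_pM => //; last exact: phig.
apply: Jth; rewrite (_ : s = c - (c - s)); last by ring.
by rewrite (le_trans (ler_normB _ _))// (le_trans _ cr)// lerD2l.
Qed.

(** Otherwise [phi] exceeds the bound on a whole interval of length [h] on which the kernel is at
    least [theta], which forces [pop J phi x] up to [2 * C1 * phi x]. *)
Lemma exists_small_value J b M B phi theta Delta C1 h u x : bounded_positive J b M B ->
    bmeas phi -> (forall y, 0 < phi y) -> 0 < theta -> 0 < h -> 0 < C1 ->
    (forall s, `|s| <= Delta -> theta <= J x s) -> `|u| + h / 2 <= Delta ->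
    pop J phi x <= C1 * phi x ->
  exists2 z, `|z - (x + u)| <= h / 2 & phi z <= 2 * C1 / (theta * h) * phi x.
Proof.
move=> kJ bphi phi0 th0 h0 C10 Jth uh up; apply: contrapT => no.
have th : 0 < theta * h by rewrite mulr_gt0.
have big z : `|z - (x + u)| <= h / 2 -> 2 * C1 / (theta * h) * phi x <= phi z.
  move=> zxu; rewrite leNgt; apply/negP => lt; apply: no; exists z => //.
  exact: ltW.
have g0 : 0 <= 2 * C1 / (theta * h) * phi x.
  by apply: mulr_ge0; [apply: divr_ge0; [apply: mulr_ge0 => //|]|]; exact: ltW.
have h20 : 0 <= h / 2 by rewrite divr_ge0// ltW.
have := @pop_ge_window J b M B phi theta Delta _ (- u) (h / 2) x kJ bphi
  (fun y => ltW (phi0 y)) (ltW th0) g0 h20 Jth.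
rewrite normrN => /(_ uh) H.
have {}H : theta * (2 * C1 / (theta * h) * phi x) * (2 * (h / 2)) <= pop J phi x.
  apply: H => s us; apply: big; rewrite (_ : x - s - (x + u) = - u - s)//; ring.
have : theta * (2 * C1 / (theta * h) * phi x) * (2 * (h / 2)) = 2 * (C1 * phi x).
  by field; rewrite !gt_eqF.
have := mulr_gt0 C10 (phi0 x); lra.
Qed.

(** The first window is controlled by [pop] directly, as the kernel is at least [theta] there. To
    widen it by [Delta / 2], find on each side of [x] a point where [phi] is at most a multiple of
    [phi x], and cover the wider window by those about the two points. *)
Lemma wint_growth J b M B phi theta Delta C1 n x : bounded_positive J b M B ->
    bmeas phi -> (forall y, 0 < phi y) -> 0 < theta -> 0 < Delta -> 0 < C1 ->
    (forall x s, `|s| <= Delta -> theta <= J x s) ->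
    (forall x, pop J phi x <= C1 * phi x) ->
  wint phi (Delta + n%:R * (Delta / 2)) x <=
    C1 / theta * (2 * (2 * C1 / (theta * (Delta / 2)))) ^+ n * phi x.
Proof.
move=> kJ bphi phi0 th0 D0 C10 Jth up.
have phi0' y : 0 <= phi y by exact: ltW.
elim: n x => [|n IH] x.
  rewrite mul0r addr0 expr0 mulr1 mulrAC ler_pdivlMr//; apply: le_trans (up x).
  rewrite mulrC -RintegralZl//; last exact: wint_int.
  have i1 := pop_int x kJ bphi.
  rewrite -(Rintegral_subr x); last by apply: integrableZ; exact: wint_int.
  apply: le_Rintegral => //.
    by apply: (@integrable_subr R x (fun y => theta * (phi y * ind Delta (x - y)))); apply: integrableZ; exact: wint_int.
  move=> s _; rewrite (_ : x - (x - s) = s); last by ring.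
  rewrite mulrCA [leRHS]mulrC ler_wpM2l//.
  rewrite indE; case: (leP _ Delta) => sD; first by rewrite mulr1 Jth.
  by rewrite mulr0 (J_ge0 kJ).
set h := Delta / 2; have h0 : 0 < h by rewrite divr_gt0.
(* Searching within [h / 2] of the offset [3 / 2 * h] puts the point at a distance between [h] and
   [2 * h] from [x], as [wint_cover] requires, and no farther than [Delta = 2 * h]. *)
have uh : 3 / 2 * h + h / 2 <= Delta by rewrite /h; lra.
have n32 : `|3 / 2 * h| = 3 / 2 * h by apply: ger0_norm; apply: mulr_ge0; [exact: divr_ge0|exact: ltW].
have [z zx pz] := @exists_small_value J b M B phi theta Delta C1 h (3 / 2 * h) x
  kJ bphi phi0 th0 h0 C10 (Jth x) (etrans (congr1 (fun t => t + h / 2 <= Delta) n32) uh) (up x).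
have n32' : `|- (3 / 2 * h)| = 3 / 2 * h by rewrite normrN.
have [z' zx' pz'] := @exists_small_value J b M B phi theta Delta C1 h (- (3 / 2 * h)) x
  kJ bphi phi0 th0 h0 C10 (Jth x) (etrans (congr1 (fun t => t + h / 2 <= Delta) n32') uh) (up x).
set r := Delta + n%:R * h.
have -> : Delta + n.+1%:R * h = r + h by rewrite /r -natr1; ring.
apply: (@le_trans _ _ (wint phi r z + wint phi r z')).
  apply: wint_cover => //.
  - have -> : 2 * h = Delta by rewrite /h; field.
    by rewrite /r lerDl; apply: mulr_ge0 => //; exact: ltW.
  - by move: zx; rewrite ler_norml => /andP[? ?]; apply/andP; split; lra.
  - by move: zx'; rewrite ler_norml => /andP[? ?]; apply/andP; split; lra.
set G := 2 * C1 / (theta * h); set A := C1 / theta * (2 * G) ^+ n.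
have A0 : 0 <= A.
  have G0 : 0 <= 2 * G.
    apply: mulr_ge0 => //; apply: divr_ge0; last by rewrite ltW// mulr_gt0.
    by apply: mulr_ge0 => //; exact: ltW.
  by apply: mulr_ge0; [apply: divr_ge0; exact: ltW|exact: exprn_ge0].
have -> : C1 / theta * (2 * G) ^+ n.+1 * phi x = A * (G * phi x) + A * (G * phi x).
  by rewrite /A exprS; ring.
have IHA y : wint phi r y <= A * phi y by exact: IH.
by apply: lerD; [apply: (le_trans (IHA z))|apply: (le_trans (IHA z'))]; rewrite ler_wpM2l.
Qed.

(** By [k2], the value at [x - s] is bounded by [pop] there, hence by [k] times the integral of
    [phi] within [r0] of [x - s]. That interval lies within [2 * r0] of [x], where [wint_growth]
    applies. *)
Lemma harnack J b M B phi theta Delta k r0 k2 C1 n x s : bounded_positive J b M B ->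
    bmeas phi -> (forall y, 0 < phi y) -> 0 < theta -> 0 < Delta -> 0 < C1 ->
    0 < k2 -> 0 < k ->
    (forall x s, `|s| <= Delta -> theta <= J x s) ->
    (forall x s, J x s <= k) -> (forall x s, r0 <= `|s| -> J x s = 0) ->
    (forall x, k2 * phi x <= pop J phi x) ->
    (forall x, pop J phi x <= C1 * phi x) ->
    2 * r0 <= Delta + n%:R * (Delta / 2) -> `|s| <= r0 ->
  phi (x - s) <=
    k / k2 * (C1 / theta * (2 * (2 * C1 / (theta * (Delta / 2)))) ^+ n) * phi x.
Proof.
move=> kJ bphi phi0 th0 D0 C10 k20 k0 Jth Jk Jr0 low up nr sr.
have phi0' y : 0 <= phi y by exact: ltW.
set A := C1 / theta * _.
have := wint_growth n x kJ bphi phi0 th0 D0 C10 Jth up; rewrite -/A.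
set r := Delta + _ => gr.
rewrite -mulrA mulrAC ler_pdivlMr// mulrC; apply: (le_trans (low _)).
apply: (@le_trans _ _ (k * wint phi r x)); last by rewrite ler_wpM2l// ltW.
have iw := wint_int r x bphi.
have i1 := pop_int (x - s) kJ bphi.
rewrite -RintegralZl// -(Rintegral_subr (x - s)); last exact: integrableZ.
apply: le_Rintegral => //.
  by apply: (@integrable_subr R (x - s) (fun y => k * (phi y * ind r (x - y)))); exact: integrableZ.
move=> t _; rewrite (_ : x - (x - s - t) = s + t); last by ring.
have [tr|rt] := leP r0 `|t|.
  by rewrite Jr0// mul0r mulr_ge0 ?(ltW k0)// mulr_ge0// ind_ge0.
rewrite indE (_ : (`|s + t| <= r)%R = true); last first.
  by rewrite (le_trans (ler_normD _ _))// (le_trans _ nr)// mulr2n mulrDl mul1r lerD// ltW.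
by rewrite mulr1 ler_wpM2r.
Qed.

End harnack.

(** * Comparability of almost fixed points on the support of the kernel *)

Section comparability.
Context {R : realType}.
Local Notation mu := (@lebesgue_measure R).
Implicit Types (J : R -> R -> R) (b w phi : R -> R) (x : R).

(** Bounding [w] below by its infimum [i] inside [gop] gives [i >= ln q + (1 - eps) * i - eta],
    because [q] bounds [qop J b (cst 1)] from below. *)
Lemma quasi_fixed_ge J b M B eps w eta q : bounded_positive J b M B ->
    0 < eps < 1 -> buc w -> (forall x, `|gop J b eps w x - w x| <= eta) ->
    0 < q -> (forall x, q <= \int[mu]_s J x s + b x) ->
  forall x, ln q - eta <= eps * w x.
Proof.
move=> kJ e01 bw wfix q0 qJ x; have [[C wC] _] := bw.
have /andP[e0 e1] := e01; have e1' : 0 <= 1 - eps by rewrite subr_ge0 ltW.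
pose D := [set w x | x in setT].
have D0 : D !=set0 by exists (w 0); exists 0.
have lbD : has_lbound D.
  by exists (- C) => _ [y _ <-]; have := wC y; rewrite ler_norml => /andP[].
have leS y : inf D <= w y by apply: ge_inf => //; exists y.
have HS : ln q + (1 - eps) * inf D - eta <= inf D.
  apply: lb_le_inf => // _ [y _ <-].
  have : ln q + (1 - eps) * inf D <= gop J b eps w y.
    rewrite -ler_expR expRD lnK ?posrE// (expR_gop kJ) mulrC.
    apply: (@le_trans _ _ (expR ((1 - eps) * inf D) * qop J b (cst 1) y)).
      by rewrite ler_wpM2l ?expR_ge0// qop_cst1.
    rewrite -ler_pdivlMl ?expR_gt0// mulrC -mulrC -expRN.
    apply: (qop_le _ kJ); [exact: bmeas_cst|exact: ephi_bmeas|move=> z].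
    by rewrite /= -expRD -[leLHS]expR0 ler_expR addrC -mulrBr mulr_ge0// subr_ge0.
  by have := wfix y; rewrite ler_norml => /andP[_ ?]; lra.
have : eps * inf D <= eps * w x by rewrite ler_wpM2l// ltW.
by rewrite mulrBl mul1r in HS; lra.
Qed.

(** Harnack's inequality needs [pop] to dominate a multiple of [phi]. At an almost fixed point [qop]
    is at least [q * (1 - 2 * eta)] times [phi], while the term in [b] takes at most [q - kap] of
    it. *)
Lemma comparable_of_gap J b M B theta Delta k r0 q kap :
    bounded_positive J b M B -> 0 < theta -> 0 < Delta -> 0 < k -> 0 < r0 ->
    (forall x s, `|s| <= Delta -> theta <= J x s) -> (forall x s, J x s <= k) ->
    (forall x s, r0 <= `|s| -> J x s = 0) -> 0 < kap ->
    (forall x, q <= \int[mu]_s J x s + b x) -> (forall x, b x + kap <= q) ->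
  exists H eta0, [/\ 0 <= H, 0 < eta0 & comparable_on_support J b (M + B) H eta0].
Proof.
move=> kJ th0 D0 k0 r00 Jth Jk Jr0 kap0 qJ bq.
have MB0 : 0 < M + B by rewrite (lt_le_trans ltr01)// (bounded_positive_ge1 kJ).
have q0 : 0 < q by have := bq 0; have := b_ge1 kJ 0; lra.
(* Chosen so that [q * (1 - 2 * eta) = q - kap / 2], which leaves [kap / 2] to the integral part. *)
pose eta := kap / 4 / q.
have eta0 : 0 < eta by rewrite !divr_gt0.
have [n nr] : exists n, 2 * r0 <= Delta + n%:R * (Delta / 2).
  exists (Num.bound (4 * r0 / Delta)).
  have : 4 * r0 / Delta < (Num.bound (4 * r0 / Delta))%:R.
    by apply: archi_boundP; apply: divr_ge0; [apply: mulr_ge0 => //|]; exact: ltW.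
  rewrite ltr_pdivrMr//; lra.
pose C1 := (M + B) * expR eta.
have C10 : 0 < C1 by rewrite mulr_gt0// expR_gt0.
have k20 : 0 < kap / 2 by rewrite divr_gt0.
pose H := k / (kap / 2) * (C1 / theta * (2 * (2 * C1 / (theta * (Delta / 2)))) ^+ n).
have H0 : 0 <= H.
  have td : 0 <= theta * (Delta / 2) by rewrite ltW// mulr_gt0// divr_gt0.
  apply: mulr_ge0; first by apply: divr_ge0; exact: ltW.
  apply: mulr_ge0; first by apply: divr_ge0; exact: ltW.
  apply: exprn_ge0; apply: mulr_ge0 => //; apply: divr_ge0 => //.
  by apply: mulr_ge0 => //; exact: ltW.
exists H, eta; split => // eps w e01 bw wB wfix.
have bphi := ephi_bmeas eps bw.
have phi0 y : 0 < ephi eps w y by exact: ephi_gt0.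
have low x : kap / 2 * ephi eps w x <= pop J (ephi eps w) x.
  have lowq : q * (1 - 2 * eta) * ephi eps w x <= qop J b (ephi eps w) x.
    rewrite -(expR_gop kJ); apply: (@le_trans _ _ (expR (ln q - 2 * eta) * ephi eps w x)).
      rewrite ler_wpM2r ?(ltW (phi0 x))// expRD lnK ?posrE// ler_wpM2l ?(ltW q0)//.
      exact: expR_ge1Dx.
    rewrite /ephi -expRD ler_expR.
    have := quasi_fixed_ge kJ e01 bw wfix q0 qJ x.
    by have := wfix x; rewrite ler_norml => /andP[? _]; lra.
  have qe : q * (1 - 2 * eta) = q - kap / 2 by rewrite /eta; field; exact: lt0r_neq0.
  rewrite qe in lowq.
  have : (q - kap / 2 - b x) * ephi eps w x <= pop J (ephi eps w) x.
    by rewrite mulrBl lerBlDr.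
  apply: le_trans; rewrite ler_wpM2r ?(ltW (phi0 x))//.
  by have := bq x; lra.
have up x : pop J (ephi eps w) x <= C1 * ephi eps w x.
  apply: (@le_trans _ _ (qop J b (ephi eps w) x)).
    by rewrite /qop lerDl mulr_ge0 ?(ltW (phi0 x))// (le_trans ler01)// (b_ge1 kJ).
  rewrite -(expR_gop kJ); apply: (@le_trans _ _ (expR (ln (M + B) + eta) * ephi eps w x)).
    rewrite /ephi -expRD ler_expR; have := wB x.
    by have := wfix x; rewrite ler_norml => /andP[_ ?] ?; lra.
  by rewrite expRD lnK ?posrE.
move=> x x'; have i1 := J_diff_int kJ x x'.
have [mphi [C phiC]] := bphi.
rewrite /edist /ddist mulrAC mulrC -RintegralZr//.
  apply: le_Rintegral => //.
  - apply: (integrable_mul_bounded i1 (bmeas_subr x' bphi)) => s; exact: phiC.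
  - by have := integrableZ (H * ephi eps w x') i1; apply: eq_integrable => // s _ /=; rewrite mulrC.
  move=> s _; have [sr|sr] := leP r0 `|s|; first by rewrite !Jr0// subrr normr0 !mul0r.
  rewrite ler_wpM2l//.
  have := harnack x' kJ bphi phi0 th0 D0 C10 k20 k0 Jth Jk Jr0 low up nr (ltW sr).
  exact.
Qed.

Lemma comparable_of_convolution J b S : (forall x x' s, J x s = J x' s) ->
  comparable_on_support J b S 0 1.
Proof.
move=> JJ eps w _ _ _ _ x x'; rewrite !mul0r le_eqVlt; apply/orP; left; apply/eqP.
rewrite /edist (@eq_Rintegral _ _ _ mu setT (cst 0)); first by rewrite Rintegral_cst ?mul0r.
by move=> s _; rewrite (JJ x x') subrr normr0 mul0r.
Qed.

End comparability.

(** * Consequences of almost periodicity *)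

Section almost_periodicity.
Context {R : realType}.
Implicit Types (J : R -> R -> R) (a b : R -> R) (x t : R).

Lemma homo_ltn_ge_id (s : nat -> nat) : {homo s : n m / (n < m)%N} ->
  forall n, (n <= s n)%N.
Proof. by move=> hs; elim=> // n IH; rewrite (leq_ltn_trans IH)// hs. Qed.

(** If density fails, choose translations one after the other, each far from every translation of
    size at most [r n], where [r n] bounds all earlier choices. No two terms of this sequence are
    close. *)
Lemma relatively_dense_of_sequences J b :
  (forall (u : nat -> R) d, 0 < d -> exists i j, (i < j)%N /\
     translates_close J b d (u j) (u i)) ->
  relatively_dense_translates J b.
Proof.
move=> H d d0; apply: contrapT => no.
have far R0 : exists t, forall t', `|t'| <= R0 -> ~ translates_close J b d t t'.
  apply: contrapT => no'; apply: no; exists R0 => t; apply: contrapT => no''.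
  by apply: no'; exists t => t' t'R cl; apply: no''; exists t'.
have [c cP] := choice far.
pose r := fix r n := if n is n'.+1 then Num.max (r n') `|c (r n')| else 0.
have r_le i j : (i <= j)%N -> r i <= r j.
  elim: j => [|j IH]; first by rewrite leqn0 => /eqP ->.
  rewrite leq_eqVlt => /orP[/eqP -> //|]; rewrite ltnS => /IH/le_trans; apply.
  by rewrite /= le_max lexx.
have [i [j [ij]]] := H (c \o r) d d0.
apply: cP => /=; apply: le_trans (r_le _ _ ij).
by rewrite /= le_max lexx orbT.
Qed.

(** If [|a (u n)| > n], the translates by a subsequence of [u] cannot converge at 0. *)
Lemma almost_periodic_bounded a : almost_periodic a -> exists A, forall x, `|a x| <= A.
Proof.
move=> ap; apply: contrapT => no.
have big (n : nat) : exists x, n%:R < `|a x|.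
  apply: contrapT => no'; apply: no; exists n%:R => x.
  by rewrite leNgt; apply/negP => nx; apply: no'; exists x.
have [u uP] := choice big.
have [s hs [h hP]] := ap u.
have [N _ NP'] := hP 1 ltr01.
have NP n (Nn : (N <= n)%N) x : `|a (x + u (s n)) - h x| < 1 := NP' n Nn x.
pose n := (N + Num.bound (`|h 0| + 1)%R)%N.
have := NP n (leq_addr _ _) 0; rewrite add0r => H1.
have H2 : `|h 0| + 1 < n%:R.
  by rewrite (lt_le_trans (archi_boundP _))// ?ler_nat ?leq_addl.
have H3 : n%:R <= (s n)%:R :> R by rewrite ler_nat homo_ltn_ge_id.
have := uP (s n); have := ler_normB (a (u (s n)) - h 0) (- h 0).
rewrite opprK subrK normrN; lra.
Qed.

(** Recentre pairs violating uniform continuity at 0 and extract: all late translates are uniformly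
    close to one of them, so continuity of that single translate at 0 makes their increments
    small. *)
Lemma almost_periodic_uc a : continuous a -> almost_periodic a ->
  forall d, 0 < d -> exists2 r, 0 < r & forall x x', `|x - x'| <= r -> `|a x - a x'| <= d.
Proof.
move=> ca ap d d0; apply: contrapT => no.
have bad (n : nat) : exists z : R * R, `|z.1 - z.2| <= n.+1%:R^-1 /\ d < `|a z.1 - a z.2|.
  apply: contrapT => no'; apply: no; exists n.+1%:R^-1; first by rewrite invr_gt0.
  move=> x x' xx'; rewrite leNgt; apply/negP => dx; apply: no'.
  by exists (x, x').
have [z zP] := choice bad.
have [s hs [h hP]] := ap (fun n => (z n).1).
have d8 : 0 < d / 8 by rewrite divr_gt0.
have [N _ NP'] := hP _ d8.
have NP n (Nn : (N <= n)%N) x : `|a (x + (z (s n)).1) - h x| < d / 8 := NP' n Nn x.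
set y := (z (s N)).1.
have : \forall t \near (0 : R), `|a y - a (t + y)| <= d / 8.
  have cay : a (t + y) @[t --> (0:R)] --> a y.
    rewrite -{2}(add0r y).
    apply: (@continuous_comp _ _ _ (fun t => t + y) a); last exact: ca.
    by apply: cvgD; [exact: cvg_id|exact: cvg_cst].
  by move/cvgrPdist_le : cay; exact.
move=> /nbhs_ballP[rho /= rho0 rhoP].
pose n := (N + Num.bound (rho^-1)%R)%N.
pose t := (z (s n)).2 - (z (s n)).1.
have tr : `|t| < rho.
  rewrite /t distrC; apply: le_lt_trans (proj1 (zP (s n))) _.
  rewrite invf_plt ?posrE//.
  have H2 : rho^-1 < n%:R.
    by rewrite (lt_le_trans (archi_boundP _)) ?invr_ge0 ?(ltW rho0)// ler_nat leq_addl.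
  by rewrite (lt_trans H2)// ltr_nat ltnS homo_ltn_ge_id.
have := rhoP t; rewrite /ball/= sub0r normrN => /(_ tr).
have := NP n (leq_addr _ _) t; have := NP n (leq_addr _ _) 0.
have := NP N (leqnn _) t; have := NP N (leqnn _) 0.
have := (zP (s n)).2; rewrite !add0r -/y /t subrK -/t.
move: (h 0) (h t) (a y) (a (t + y)) (a (z (s n)).1) (a (z (s n)).2) => h0 ht ay aty a1 a2.
rewrite !ltr_norml !ler_norml => /= H /andP[? ?] /andP[? ?] /andP[? ?] /andP[? ?] /andP[? ?].
by move: H; rewrite ltNge ler_norml => /negP; apply; apply/andP; split; lra.
Qed.

End almost_periodicity.

(** * Admissible functions as positive elements of [buc] *)

Section admissible_functions.
Context {R : realType}.
Implicit Types (phi g : R -> R).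

Lemma admissibleP phi :
  admissible phi <-> buc phi /\ exists2 c, 0 < c & forall x, c <= phi x.
Proof.
split=> [[/unif_continuousP uphi inf0 supy]|[[[C phiC] uphi] [c c0 cphi]]].
  have infx x : (einf_over phi setT <= (phi x)%:E)%E.
    by apply: ereal_inf_lbound; exists x.
  have supx x : ((phi x)%:E <= esup_over phi setT)%E.
    by apply: ereal_sup_ubound; exists x.
  have infr : einf_over phi setT \is a fin_num.
    by rewrite fin_numElt (lt_trans _ inf0)//= (le_lt_trans (infx 0)) ?ltry.
  have supr : esup_over phi setT \is a fin_num.
    by rewrite fin_numElt supy (lt_le_trans _ (supx 0)) ?ltNyr.
  have cP x : fine (einf_over phi setT) <= phi x by rewrite -lee_fin fineK.
  have CP x : phi x <= fine (esup_over phi setT) by rewrite -lee_fin fineK.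
  have c0 : 0 < fine (einf_over phi setT) by rewrite -lte_fin fineK.
  split; last by exists (fine (einf_over phi setT)).
  split.
    exists (fine (esup_over phi setT)) => x; rewrite ger0_norm//.
    exact: le_trans (ltW c0) (cP x).
  move=> e e0; have [d d0 dP] := uphi _ e0.
  (* The radius is halved because [buc] uses closed inequalities and [ball] open ones. *)
  exists (d / 2) => [|x y xy]; first by rewrite divr_gt0.
  apply/ltW/(dP (x, y)); rewrite /ball/=; apply: (le_lt_trans xy).
  by rewrite ltr_pdivrMr// ltr_pMr// ltr1n.
split.
- apply/unif_continuousP => e e0.
  have [|r r0 rP] := uphi (e / 2); first by rewrite divr_gt0.
  exists r => // -[x y] /= xy; rewrite /ball/=; apply: le_lt_trans (rP _ _ (ltW xy)) _.
  by rewrite ltr_pdivrMr// ltr_pMr// ltr1n.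
- apply: (@lt_le_trans _ _ c%:E); first by rewrite lte_fin.
  by apply: le_ereal_inf_tmp => _ [x _ <-]; rewrite lee_fin.
- apply: (@le_lt_trans _ _ C%:E); last by rewrite ltry.
  apply: ge_ereal_sup => _ [x _ <-]; rewrite lee_fin.
  exact: le_trans (ler_norm _) (phiC x).
Qed.

Lemma refl_refl g : refl (refl g) = g.
Proof. by apply/funext => x; rewrite /refl opprK. Qed.

Lemma admissible_refl phi : admissible phi -> admissible (refl phi).
Proof.
move=> /admissibleP[[[C phiC] uphi] [c c0 cphi]]; apply/admissibleP; split; last by exists c => // x; rewrite /refl.
split; first by exists C => x; rewrite /refl.
move=> e e0; have [r r0 rP] := uphi _ e0; exists r => // x y xy; apply: rP.
by rewrite -opprD normrN.
Qed.

End admissible_functions.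

(** * The kernels of [L_p]: reflection, tails, and the comparison of [p] with [- p] *)

Section kernel_family.
Context {R : realType}.
Local Notation mu := (@lebesgue_measure R).
Implicit Types (K : R -> R -> R) (a phi : R -> R) (p x : R).

(** The kernel of [L_p] in the offset variable of [pop], the form in which [K1], [K6] and [K8] speak
    of it. *)
Definition Jk K p x s := Kp K p x (x - s).

Lemma JkE K p x s : Jk K p x s = K x (x - s) * expR (- (p * s)).
Proof. by rewrite /Jk /Kp; congr (_ * expR _); ring. Qed.

Lemma Kp_ge0 K p x y : nonneg_kernel K -> 0 <= Kp K p x y.
Proof. by move=> [_ K0]; rewrite mulr_ge0 ?expR_ge0. Qed.

Lemma measurable_Kp K p : nonneg_kernel K ->
  measurable_fun [set: R * R] (fun z : R * R => Kp K p z.1 z.2).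
Proof.
move=> [mK _]; apply: measurable_funM => //.
have m1 : measurable_fun [set: R * R] (fun z : R * R => p * (z.2 - z.1)).
  by apply: measurable_funM => //; apply: measurable_funB.
exact: (measurableT_comp (@measurable_expR R) m1).
Qed.

Lemma integrable_Jk K p x : K1 K -> mu.-integrable setT (EFin \o Jk K p x).
Proof.
move=> [_ /(_ p)[/(_ x) iK _ _]]; apply: eq_integrable iK => // s _ /=.
by rewrite JkE.
Qed.

Lemma integrable_Kp K p x : K1 K -> mu.-integrable setT (EFin \o Kp K p x).
Proof.
move=> /(integrable_Jk p x)/(integrable_subr x); apply: eq_integrable => // y _ /=.
by rewrite /Jk; congr (EFin (Kp _ _ _ _)); ring.
Qed.

Lemma Rintegral_Jk K p x : K1 K -> \int[mu]_s Jk K p x s = mass (Kp K p) x.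
Proof.
by move=> h1; rewrite /mass -[RHS](Rintegral_subr x (integrable_Kp p x h1)).
Qed.

Lemma shifted_massE K p x : K1 K -> shifted_mass K p x = mass (Kp K p) x.
Proof.
by move=> h1; rewrite -(Rintegral_Jk p x h1); apply: eq_Rintegral => s _; rewrite JkE.
Qed.

Lemma Kp0 K : Kp K 0 = K.
Proof. by apply/funext => x; apply/funext => y; rewrite /Kp mul0r expR0 mulr1. Qed.

Lemma mass_bounded K p : nonneg_kernel K -> K1 K ->
  exists M, forall x, mass (Kp K p) x <= M.
Proof.
move=> hK h1; have [_ /(_ p)[_ [M MP] _]] := h1; exists M => x.
by rewrite -shifted_massE// (le_trans (ler_norm _)).
Qed.

Lemma mass_continuous K : K1 K -> continuous (mass K).
Proof.
move=> h1; have [_ /(_ 0)[_ _ cK]] := h1.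
rewrite (_ : mass K = shifted_mass K 0)//.
by apply/funext => x; rewrite shifted_massE// Kp0.
Qed.

Lemma integrable_Kp_mul K p x phi : K1 K -> bmeas phi ->
  mu.-integrable setT (EFin \o (fun y => Kp K p x y * phi y)).
Proof.
by move=> h1 [mphi [C phiC]]; exact: (integrable_mul_bounded (integrable_Kp p x h1) mphi phiC).
Qed.

Lemma buc_bmeas phi : buc phi -> bmeas phi.
Proof. by move=> bphi; split; [exact: buc_measurable|case: bphi]. Qed.

Lemma LopE K a p phi x : K1 K -> bmeas phi ->
  Lop K a p phi x = pop (Jk K p) phi x - a x * phi x.
Proof.
move=> h1 bphi; congr (_ - _).
exact/esym/(Rintegral_subr x (integrable_Kp_mul p x h1 bphi)).
Qed.

Lemma Kp_sym K p x y : symmetric_kernel K -> Kp K (- p) y x = Kp K p x y.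
Proof. by move=> sK; rewrite /Kp sK; congr (_ * expR _); ring. Qed.

(** The substitution of [- y] for [y] reverses the sign of [y - x] in the exponent. *)
Lemma reflected_Lop K a p phi x : K1 K -> bmeas phi ->
  Lop (reflK K) (refl a) p phi x = Lop K a (- p) (refl phi) (- x).
Proof.
move=> h1 [mphi [C phiC]]; rewrite /Lop /refl opprK; congr (_ - _).
have bphi' : bmeas (fun y => phi (- y)).
  by split; [exact: (measurableT_comp mphi)|exists C => y; exact: phiC].
transitivity (\int[mu]_y (Kp K (- p) (- x) y * phi (- y))); last first.
  by apply: eq_Rintegral => y _; rewrite /Kp opprK.
rewrite -[RHS](Rintegral_subr 0 (integrable_Kp_mul (- p) (- x) h1 bphi')).
apply: eq_Rintegral => y _; rewrite /reflK /Kp sub0r !opprK.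
by congr (_ * expR _ * _); ring.
Qed.

Lemma lambda_low_reflected K a p : K1 K ->
  lambda_low (reflK K) (refl a) p = lambda_low K a (- p).
Proof.
move=> h1; congr (ereal_sup [set _%:E | _ in _]); apply/funext => l; apply/propext.
have adm phi : admissible phi -> bmeas phi by move=> /admissibleP[/buc_bmeas].
split=> -[phi aphi lphi].
  exists (refl phi) => [|x]; first exact: admissible_refl.
  by have := lphi (- x); rewrite reflected_Lop ?opprK//; exact: adm.
exists (refl phi) => [|x]; first exact: admissible_refl.
rewrite reflected_Lop// ?refl_refl; last exact/adm/admissible_refl.
exact: lphi.
Qed.

Lemma lambda_up_reflected K a p : K1 K ->
  lambda_up (reflK K) (refl a) p = lambda_up K a (- p).
Proof.
move=> h1; congr (ereal_inf [set _%:E | _ in _]); apply/funext => l; apply/propext.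
have adm phi : admissible phi -> bmeas phi by move=> /admissibleP[/buc_bmeas].
split=> -[phi aphi lphi].
  exists (refl phi) => [|x]; first exact: admissible_refl.
  by have := lphi (- x); rewrite reflected_Lop ?opprK//; exact: adm.
exists (refl phi) => [|x]; first exact: admissible_refl.
rewrite reflected_Lop// ?refl_refl; last exact/adm/admissible_refl.
exact: lphi.
Qed.

(** A Chernoff bound: at distance at least [L] from [x], the kernel for [p] is at most [expR (- L)]
    times the sum of those for [p + 1] and [p - 1], whose masses are bounded in [x]. *)
Lemma Kp_tail K p d : nonneg_kernel K -> K1 K -> 0 < d -> exists2 L, 0 < L &
  forall x r, `|x| + L <= r -> \int[mu]_y (Kp K p x y * (1 - ind r y)) <= d.
Proof.
move=> hK h1 d0; have [M1 M1P] := mass_bounded (p + 1) hK h1.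
have [M2 M2P] := mass_bounded (p - 1) hK h1.
have mass_ge0 q : 0 <= mass (Kp K q) 0 by apply: Rintegral_ge0 => y _; exact: Kp_ge0.
have S0 : 0 <= M1 + M2.
  by apply: addr_ge0; [apply: le_trans (M1P 0)|apply: le_trans (M2P 0)].
(* With [1 + L <= expR L] this gives [expR (- L) * (M1 + M2) <= d]. *)
pose L := (M1 + M2) / d + 1.
have L0 : 0 < L by rewrite ltr_wpDl// divr_ge0// ltW.
exists L => // x r xr.
have i1 := integrable_Kp (p + 1) x h1; have i2 := integrable_Kp (p - 1) x h1.
have i12 := integrable_add i1 i2.
apply: (@le_trans _ _ (expR (- L) * (mass (Kp K (p + 1)) x + mass (Kp K (p - 1)) x))).
  rewrite /mass -RintegralD// -RintegralZl//; apply: le_Rintegral => //.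
  - apply: (@integrable_mul_bounded _ _ _ 1 (integrable_Kp p x h1)).
      by apply: measurable_funB; [exact: measurable_cst|exact: measurable_ind].
    by move=> y; rewrite ger0_norm ?subr_ge0 ?ind_le1// gerBl ind_ge0.
  - exact: integrableZ.
  move=> y _; rewrite indE; case: (leP `|y| r) => yr.
    by rewrite subrr mulr0 mulr_ge0 ?expR_ge0// addr_ge0// Kp_ge0.
  rewrite subr0 mulr1; have xy : L <= `|y - x|.
    by have := ler_normD (y - x) x; rewrite subrK; lra.
  have KpE q : Kp K q x y = K x y * expR (q * (y - x)) by [].
  have K0 := hK.2 x y.
  rewrite !KpE -mulrDr mulrCA ler_wpM2l// [leRHS]mulrDr -!expRD.
  have [yx|xy'] := leP 0 (y - x).
    rewrite ger0_norm// in xy; apply: (@le_trans _ _ (expR (- L + (p + 1) * (y - x)))).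
      by rewrite ler_expR; lra.
    by rewrite lerDl expR_ge0.
  rewrite ltr0_norm// in xy; apply: (@le_trans _ _ (expR (- L + (p - 1) * (y - x)))).
    by rewrite ler_expR; lra.
  by rewrite lerDr expR_ge0.
apply: (@le_trans _ _ (expR (- L) * (M1 + M2))).
  by rewrite ler_wpM2l ?expR_ge0// lerD.
rewrite expRN -ler_pdivlMl ?invr_gt0 ?expR_gt0// invrK.
have := expR_ge1Dx L; rewrite -(ler_pM2r d0); apply: le_trans.
have : (M1 + M2) / d * d = M1 + M2 by rewrite divfK// gt_eqF.
rewrite /L; move: ((M1 + M2) / d) => q; lra.
Qed.

Lemma lambda_low_le_up K a p A : nonneg_kernel K -> K1 K -> symmetric_kernel K ->
  continuous a -> (forall x, `|a x| <= A) ->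
  (lambda_low K a p <= lambda_up K a (- p))%E.
Proof.
move=> hK h1 sK ca aA; apply: ge_ereal_sup => _ [l [phi aphi phil] <-].
apply: le_ereal_inf_tmp => _ [m [psi apsi psim] <-]; rewrite lee_fin.
move/admissibleP : aphi => [bphi [c1 c10 c1phi]].
move/admissibleP : apsi => [bpsi [c2 c20 c2psi]].
have [[C1 phiC] _] := bphi; have [[C2 psiC] _] := bpsi.
have [M MP] := mass_bounded p hK h1.
apply: (@bilinear_comparison R (Kp K p) a phi psi M A (Num.min c1 c2) (Num.max C1 C2)) => //.
- exact: measurable_Kp.
- by move=> x y; exact: Kp_ge0.
- by move=> x; exact: integrable_Kp.
- move=> y; have := integrable_Kp (- p) y h1; apply: eq_integrable => // x _ /=.
  by rewrite Kp_sym.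
- by move=> d; exact: Kp_tail.
- exact: continuous_measurable_fun.
- by rewrite lt_min c10.
- exact: buc_measurable.
- exact: buc_measurable.
- by move=> x; rewrite ge_min c1phi/= le_max (le_trans (ler_norm _) (phiC x)).
- by move=> x; rewrite ge_min c2psi orbT/= le_max (le_trans (ler_norm _) (psiC x)) orbT.
- move=> y; apply: le_trans (psim y).
  rewrite le_eqVlt; apply/orP; left; apply/eqP; congr (_ - _).
  by apply: eq_Rintegral => x _; rewrite -(Kp_sym p x y sK).
Qed.

End kernel_family.

(** * The reverse inequality under each of the two conditions *)

Section quasi_eigenvalue.
Context {R : realType}.
Local Notation mu := (@lebesgue_measure R).
Implicit Types (K : R -> R -> R) (a b phi : R -> R) (p x : R).

(** One function tests both eigenvalues: after removal of the shift [m], the upper one is at most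
    [l + delta - m] and the lower one at least [l - m]. *)
Lemma lambda_up_le_low_of_quasi_eigen K a p m : K1 K ->
  (forall delta, 0 < delta -> exists phi l, [/\ buc phi,
     exists2 c, 0 < c & forall x, c <= phi x,
     forall x, l * phi x <= qop (Jk K p) (fun x => m - a x) phi x &
     forall x, qop (Jk K p) (fun x => m - a x) phi x <= (l + delta) * phi x]) ->
  (lambda_up K a p <= lambda_low K a p)%E.
Proof.
move=> h1 H; apply/lee_addgt0Pr => delta delta0.
have [phi [l [bphi cphi low up]]] := H _ delta0.
have aphi : admissible phi by apply/admissibleP.
have LE x : Lop K a p phi x = qop (Jk K p) (fun x => m - a x) phi x - m * phi x.
  by rewrite LopE//; [rewrite /qop; ring|exact: buc_bmeas].
apply: (@le_trans _ _ (l + delta - m)%:E).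
  apply: ereal_inf_lbound; exists (l + delta - m) => //; exists phi => // x.
  by rewrite LE mulrBl lerB.
rewrite (_ : l + delta - m = l - m + delta); last by ring.
rewrite EFinD leeD2r//; apply: ereal_sup_ubound; exists (l - m) => //; exists phi => // x.
by rewrite LE mulrBl lerB.
Qed.

Lemma Jk_bounded_positive K a p A M : nonneg_kernel K -> K1 K ->
  (forall x, `|a x| <= A) -> (forall x, mass (Kp K p) x <= M) ->
  bounded_positive (Jk K p) (fun x => A + 1 - a x) M (2 * A + 1).
Proof.
move=> hK h1 aA MP; split.
- by move=> x s; exact: Kp_ge0.
- by move=> x; exact: integrable_Jk.
- by move=> x; rewrite (Rintegral_Jk p x h1).
- by move=> x; have := aA x; rewrite ler_norml => /andP[? ?]; lra.
- by move=> x; have := aA x; rewrite ler_norml => /andP[? ?]; lra.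
Qed.

Lemma Jk_lower_bound K p theta0 Delta k0 x s : K3' K theta0 Delta k0 ->
  `|s| <= Delta -> theta0 * expR (- (`|p| * Delta)) <= Jk K p x s.
Proof.
move=> [th0 D0 _ Kth _] sD; rewrite JkE; apply: ler_pM; rewrite ?(ltW th0) ?expR_ge0//.
  by apply: Kth; rewrite (_ : x - (x - s) = s)//; ring.
rewrite ler_expR lerN2 (le_trans (ler_norm _))// normrM; exact: ler_wpM2l.
Qed.

(** The part common to both conditions; the last three hypotheses isolate what each has to supply by
    its own means. *)
Lemma lambda_up_le_low K a p theta0 Delta k0 : nonneg_kernel K -> K1 K ->
    K3' K theta0 Delta k0 -> continuous a -> almost_periodic a ->
    (forall d, 0 < d -> exists2 r, 0 < r &
       forall x x', `|x - x'| <= r -> ddist (Jk K p) x x' <= d) ->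
    (forall u : nat -> R, exists2 sigma : nat -> nat,
       {homo sigma : n m / (n < m)%N} & forall d, 0 < d -> exists N, forall n m,
         (N <= n)%N -> (N <= m)%N ->
         forall x, ddist (Jk K p) (x + u (sigma n)) (x + u (sigma m)) <= d) ->
    (forall A M, (forall x, `|a x| <= A) -> (forall x, mass (Kp K p) x <= M) ->
       exists H eta0, [/\ 0 <= H, 0 < eta0 & comparable_on_support (Jk K p)
         (fun x => A + 1 - a x) (M + (2 * A + 1)) H eta0]) ->
  (lambda_up K a p <= lambda_low K a p)%E.
Proof.
move=> hK h1 h3 ca ap huc hseq hcomp.
have [A aA] := almost_periodic_bounded ap.
have [M MP] := mass_bounded p hK h1.
have [H [eta0 [H0 eta00 cmp]]] := hcomp A M aA MP.
have kJ := Jk_bounded_positive hK h1 aA MP.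
have [th0 D0 _ _ _] := h3.
have bE x x' : `|A + 1 - a x - (A + 1 - a x')| = `|a x - a x'|.
  by rewrite distrC; congr `|_|; ring.
apply: (@lambda_up_le_low_of_quasi_eigen K a p (A + 1)) => // delta delta0.
apply: (quasi_eigenfunction kJ (theta := theta0 * expR (- (`|p| * Delta))) (Delta := Delta) (H := H) (eta0 := eta0)) => //.
- move=> d d0; have [r1 r10 r1P] := huc _ d0; have [r2 r20 r2P] := almost_periodic_uc ca ap d0.
  exists (Num.min r1 r2) => [|x x']; first by rewrite lt_min r10.
  by rewrite le_min => /andP[xr1 xr2]; rewrite bE; split; [exact: r1P|exact: r2P].
- by rewrite mulr_gt0// expR_gt0.
- by move=> x s; exact: (Jk_lower_bound p x h3).
apply: relatively_dense_of_sequences => u d d0.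
(* Extract for the kernel, then for [a] within that subsequence; two consecutive late terms are
   close for both. *)
have [s1 hs1 s1P] := hseq u; have [s2 hs2 [h hP]] := ap (u \o s1).
have [N1 N1P] := s1P _ d0.
have d2 : 0 < d / 2 by rewrite divr_gt0.
have [N2 _ N2P'] := hP _ d2.
have N2P n (Nn : (N2 <= n)%N) x : `|a (x + u (s1 (s2 n))) - h x| < d / 2 := N2P' n Nn x.
pose n := maxn N1 N2.
have nN2 : (N2 <= n)%N by exact: leq_maxr.
have N1s m : (n <= m)%N -> (N1 <= s2 m)%N.
  by move=> nm; rewrite (leq_trans (leq_maxl N1 N2))// (leq_trans nm)// homo_ltn_ge_id.
exists (s1 (s2 n)), (s1 (s2 n.+1)); split; first exact/hs1/hs2.
move=> x; split; first by apply: N1P; apply: N1s.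
rewrite bE; have := N2P n nN2 x; have := N2P n.+1 (leqW nN2) x.
rewrite !ltr_norml ler_norml => /andP[? ?] /andP[? ?]; apply/andP; split; lra.
Qed.

Lemma ddist_diag_dist K p r0 u v : (forall x y, r0 <= `|x - y| -> K x y = 0) ->
  ddist (Jk K p) u v = diag_dist K p r0 u v.
Proof.
move=> K0; rewrite /diag_dist Rintegral_mkcond; apply: eq_Rintegral => s _.
rewrite patchE; case: ifPn => // /negP sr.
have rs : r0 <= `|s|.
  rewrite leNgt; apply/negP => lt; apply: sr; rewrite inE /ball/=.
  by rewrite sub0r normrN.
by rewrite !JkE !K0 ?mul0r ?subrr ?normr0// (_ : _ - (_ - s) = s)//; ring.
Qed.

(** This turns the positivity of [kappa] into the gap [b x + kap <= q] of [comparable_of_gap], with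
    [b = A + 1 - a]. *)
Lemma kappa_gap K f p A x : nonneg_kernel K -> (forall x, `|coef_a K f x| <= A) ->
  A + 1 - coef_a K f x + kappa K f <=
    inf (range (mass (Kp K p))) + (A + 1 - sup (range (coef_a K f))).
Proof.
move=> hK aA; rewrite /kappa.
have mass0 q y : 0 <= mass (Kp K q) y by apply: Rintegral_ge0 => z _; exact: Kp_ge0.
have h1 : inf (range (fun p => inf (range (mass (Kp K p))))) <= inf (range (mass (Kp K p))).
  apply: ge_inf; last by exists p.
  exists 0 => _ [q _ <-]; apply: lb_le_inf; first by exists (mass (Kp K q) 0); exists 0.
  by move=> _ [y _ <-].
have h2 : inf (range (coef_a K f)) <= coef_a K f x.
  apply: ge_inf; last by exists x.
  by exists (- A) => _ [y _ <-]; have := aA y; rewrite ler_norml => /andP[].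
lra.
Qed.

Lemma lambda_up_le_low_i K f p : nonneg_kernel K -> continuous (coef_a K f) ->
  condition_i K f -> (lambda_up K (coef_a K f) p <= lambda_low K (coef_a K f) p)%E.
Proof.
move=> hK ca [[theta0 [Delta [k0 [r0 [h3 [Dr0 K0] h8]]]]] [h1 _ h6 ap kap0]].
have [th0 D0 k00 Kth Kk] := h3.
have r00 : 0 < r0 := lt_trans D0 Dr0.
apply: (lambda_up_le_low hK h1 h3 ca ap).
- move=> d d0; have /nbhs_ballP[r /= r_gt0 rP] := h6 p r0 r00 d d0.
  exists (r / 2) => [|x x' xx']; first by rewrite divr_gt0.
  have xr : `|x' - x| < r.
    by rewrite distrC (le_lt_trans xx')// ltr_pdivrMr// ltr_pMr// ltr1n.
  have := rP (x' - x); rewrite /ball/= sub0r normrN => /(_ xr) H.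
  rewrite (ddist_diag_dist _ _ _ K0) (_ : x' = x + (x' - x)); last by ring.
  exact/ltW/H.
- move=> u; have [s hs sP] := h8 p u; exists s => // d d0.
  have [[P Q] /= [[N1 _ N1P] [N2 _ N2P]] PQ] := sP _ d0.
  exists (maxn N1 N2) => n m; rewrite !geq_max => /andP[n1 n2] /andP[m1 m2] x.
  rewrite (ddist_diag_dist _ _ _ K0); apply/ltW.
  by apply: (PQ (n, m)); split; [exact: N1P|exact: N2P].
move=> A M aA MP; have kJ := Jk_bounded_positive hK h1 aA MP.
pose q := inf (range (mass (Kp K p))) + (A + 1 - sup (range (coef_a K f))).
(* On the range [|s| <= r0] the weight [expR (- (p * s))] is at most [expR (|p| * r0)], and for
   [|s| <= Delta] it is at least [expR (- (|p| * Delta))]. *)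
apply: (@comparable_of_gap _ _ _ _ _ (theta0 * expR (- (`|p| * Delta))) Delta
    (k0 * expR (`|p| * r0)) r0 q (kappa K f) kJ) => //.
- by rewrite mulr_gt0// expR_gt0.
- by rewrite mulr_gt0// expR_gt0.
- by move=> x s; exact: (Jk_lower_bound p x h3).
- move=> x s; rewrite JkE; have [sr|sr] := leP r0 `|s|.
    rewrite K0 ?mul0r ?mulr_ge0 ?expR_ge0 ?(ltW k00)//.
    by rewrite (_ : x - (x - s) = s)//; ring.
  apply: ler_pM; rewrite ?expR_ge0 ?(hK.2)// ler_expR.
  rewrite (le_trans (ler_norm _))// normrN normrM ler_wpM2l// ltW//.
- move=> x s sr; rewrite JkE K0 ?mul0r//.
  by rewrite (_ : x - (x - s) = s)//; ring.
- move=> x; rewrite (Rintegral_Jk p x h1) /q lerD//.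
    apply: ge_inf; last by exists x.
    by exists 0 => _ [y _ <-]; apply: Rintegral_ge0 => z _; exact: Kp_ge0.
  rewrite lerD2l lerN2; apply: ub_le_sup; last by exists x.
  by exists A => _ [y _ <-]; rewrite (le_trans (ler_norm _)).
- by move=> x; exact: kappa_gap.
Qed.

Lemma lambda_up_le_low_ii K f p : nonneg_kernel K -> continuous (coef_a K f) ->
  condition_ii K f -> (lambda_up K (coef_a K f) p <= lambda_low K (coef_a K f) p)%E.
Proof.
move=> hK ca [[theta0 [Delta [k0 h3]]] [h1 _ _ ap [k kP]]].
have JJ x x' s : Jk K p x s = Jk K p x' s.
  by rewrite !JkE !kP; congr (k _ * _); ring.
have dd0 x x' : ddist (Jk K p) x x' = 0.
  rewrite /ddist (@eq_Rintegral _ _ _ mu setT (cst 0)); first by rewrite Rintegral_cst ?mul0r.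
  by move=> s _; rewrite (JJ x x') subrr normr0.
apply: (lambda_up_le_low hK h1 h3 ca ap).
- by move=> d d0; exists 1 => // x x' _; rewrite dd0 ltW.
- by move=> u; exists id => // d d0; exists 0%N => n m _ _ x; rewrite dd0 ltW.
- by move=> A M _ _; exists 0, 1; split => //; exact: comparable_of_convolution.
Qed.

End quasi_eigenvalue.

(** * Closing the cycle of inequalities *)

Lemma le_cycle4_eq (R : realType) (x y z t : \bar R) :
  (x <= t)%E -> (t <= z)%E -> (z <= y)%E -> (y <= x)%E -> [/\ x = y, y = z & z = t].
Proof.
move=> xt tz zy yx.
have e1 : x = y by apply: le_anti; rewrite yx (le_trans xt (le_trans tz zy)).
have e2 : y = z by apply: le_anti; rewrite zy (le_trans yx (le_trans xt tz)).
by split => //; apply: le_anti; rewrite tz (le_trans zy (le_trans yx xt)).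
Qed.

Theorem theorem5p6 (R : realType) (K : R -> R -> R) (f : R -> R -> R)
    (hK : nonneg_kernel K) (hf : KPP_nonlinearity f)
    (ha : locally_lipschitz (coef_a K f))
    (hcond : condition_i K f \/ condition_ii K f)
    (hsym : symmetric_kernel K) (p : R) :
  [/\ lambda_low K (coef_a K f) p = lambda_up K (coef_a K f) p,
      lambda_up K (coef_a K f) p
        = lambda_low (reflK K) (refl (coef_a K f)) p
    & lambda_low (reflK K) (refl (coef_a K f)) p
        = lambda_up (reflK K) (refl (coef_a K f)) p].
Proof.
have h1 : K1 K by case: hcond => -[_ []].
have ap : almost_periodic (coef_a K f) by case: hcond => -[_ []].
have [A aA] := almost_periodic_bounded ap.
(* Continuity of [mass K] is the case [p = 0] of [K1]; that of [fs0 f] is part of the assumptions on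
   [f]. *)
have ca : continuous (coef_a K f).
  have [_ _ cf _ _] := hf => x; apply: cvgB; [exact: mass_continuous|exact: cf].
have up_low q : (lambda_up K (coef_a K f) q <= lambda_low K (coef_a K f) q)%E.
  by case: hcond => ?; [exact: lambda_up_le_low_i|exact: lambda_up_le_low_ii].
have low_up q : (lambda_low K (coef_a K f) q <= lambda_up K (coef_a K f) (- q))%E.
  exact: lambda_low_le_up aA.
rewrite (lambda_low_reflected _ _ h1) (lambda_up_reflected _ _ h1).
apply: (le_cycle4_eq (low_up p) (up_low (- p)) _ (up_low p)).
by have := low_up (- p); rewrite opprK; exact: id.
Qed.
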